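(* Let $\alpha\ge-\frac12$, let $d\ge1$ be an integer, let $s>0$ be real, and let $0<\xi<\frac12$. Let $f\in H^{s+\frac d2}(I^d)$, and let $N,m$ be integers with $1\le m\le\min\{N,d\}$, $N>e\,m-1$ and $$\frac{\frac{N+1}{m}}{\ln\left(\frac{N+1}{m}\right)}\ \ge\ -\ln(\xi)\left(1+s+\frac d2\right).$$ Suppose that $s+\frac d2>m+1$. Then, with $\|f\|:=\|f\|_2+\|f\|_{H^{s+\frac d2}(I^d)}$, $$\|f-\Pi_{N,m}(f)\|_\alpha\ \lesssim_{\alpha,d,s}\ \frac{1}{2^{(s+\frac d2)(m+1)}}\|f\|_{H^{s+\frac d2}(I^d)}+\frac{m\,\|f\|}{s+\frac d2-m}\left(2+\frac m{N+1}\right)^d\left(\frac m{N+1}\right)^{s+\frac d2-m}$$ and $$\|f-\Pi_{N,m}(f)\|_\infty\ \lesssim_{\alpha,d,s}\ \frac{1}{2^{(s+\frac d2)(m+1)}}\|f\|_{\mathcal A^s(I^d)}+\frac{\|f\|\,D(N,\alpha)^m\,m}{s+\frac d2-m}\left(2+\frac m{N+1}\right)^d\left(\frac m{N+1}\right)^{s+\frac d2-m}.$$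
   Context: $I=[-1,1]$. The notation $A\lesssim_{\alpha,d,s}B$ means $A\le c\,B$ with a constant $c$ depending only on $\alpha,d,s$. Function spaces: functions $f$ are expanded in the Fourier series $f(\boldsymbol x)=\sum_{\boldsymbol p\in\mathbb Z^d}a_{\boldsymbol p}(f)e^{2i\pi\boldsymbol p\cdot\boldsymbol x}$, i.e. they are functions on the unit torus $\mathbb T^d$ ($1$-periodic functions on $\mathbb R^d$), considered on $I^d$, with $a_{\boldsymbol p}(f)$ the usual Fourier coefficients over a unit cell. For $t>0$ let $w^{(t)}(\boldsymbol p)=\prod_{j=1}^d(1+|p_j|)^t$. Then $H^t(I^d)$ is the space of such $f\in L^2$ with $\|f\|_{H^t(I^d)}:=\big(\sum_{\boldsymbol p}(w^{(t)}(\boldsymbol p))^2|a_{\boldsymbol p}(f)|^2\big)^{1/2}<\infty$, and $\|f\|_{\mathcal A^t(I^d)}:=\sum_{\boldsymbol p}w^{(t)}(\boldsymbol p)|a_{\boldsymbol p}(f)|\in[0,\infty]$ is the weighted Wiener algebra norm. $\|\cdot\|_2$ is the norm of $L^2(I^d)$ and $\|\cdot\|_\infty$ the sup norm on $I^d$. Jacobi polynomials: let $w_\alpha(x)=(1-x^2)^\alpha$ on $I$, $\boldsymbol w_\alpha(\boldsymbol x)=\prod_{i=1}^d w_\alpha(x_i)$, and $\|g\|_\alpha^2=\int_{I^d}|g|^2\boldsymbol w_\alpha\,d\boldsymbol x$. Let $\widetilde P_k^{(\alpha)}$ be the Jacobi polynomial of degree $k$ with parameters $(\alpha,\alpha)$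 normalized by $\int_{-1}^1\widetilde P_j^{(\alpha)}\widetilde P_k^{(\alpha)}w_\alpha=\delta_{j,k}$. Let $$\mathcal P_{N,m,d}=\mathrm{Span}\Big\{\prod_{i\in\boldsymbol u}\widetilde P^{(\alpha)}_{k_i}(x_i):\ \boldsymbol u\subset\{1,\dots,d\},\ |\boldsymbol u|\le m,\ \boldsymbol k\in\mathbb N_0^d,\ k_j\ge1\ (j\in\boldsymbol u),\ k_j=0\ (j\notin\boldsymbol u),\ \|\boldsymbol k\|_1\le N\Big\}$$ (the empty product being $1$), and let $\Pi_{N,m}$ be the orthogonal projection of $L^2(I^d,\boldsymbol w_\alpha)$ onto $\mathcal P_{N,m,d}$. $D(N,\alpha)=\pi^{3/4}N^{\alpha+\frac12}e^{\alpha+\frac34}$ if $\alpha>-\frac12$, and $D(N,-\frac12)=2$. *)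

(* Defs.v *)
From HB Require Import structures.
From mathcomp Require Import all_boot all_order all_algebra.
From mathcomp Require Import finmap.
From mathcomp Require Import complex.
From mathcomp Require Import all_classical all_reals all_analysis.

Set Implicit Arguments.
Unset Strict Implicit.
Unset Printing Implicit Defensive.

Import Order.TTheory GRing.Theory Num.Theory.
Import ComplexField.Normc.

Local Open Scope classical_set_scope.
Local Open Scope complex_scope.
Local Open Scope ring_scope.

(* Points of R^n; measurableTypeR R is R with its Borel sigma-algebra, and the
   tuple type carries the corresponding product sigma-algebra. *)
Notation euclid R n := (n.-tuple (measurableTypeR R)).

Section cons_measure.
Variables (R : realType) (n : nat).

Definition consT (p : measurableTypeR R * euclid R n) : euclid R n.+1 :=
  [the n.+1.-tuple _ of p.1 :: p.2].

Definition unconsT (t : euclid R n.+1) : measurableTypeR R * euclid R n :=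
  (thead t, [tuple of behead t]).

Lemma measurable_consT : measurable_fun setT consT.
Proof. exact: (measurable_cons measurable_fst measurable_snd). Qed.

Lemma measurable_unconsT : measurable_fun setT unconsT.
Proof.
apply/measurable_fun_pairP; split.
  exact: (@measurable_tnth _ _ n.+1 ord0).
exact: measurable_behead.
Qed.

Lemma consTK : cancel consT unconsT.
Proof.
case=> x t; rewrite /unconsT /consT /= theadE; congr (_, _).
exact: val_inj.
Qed.

Variable mu : {sigma_finite_measure set (euclid R n) -> \bar R}.

Definition cons_measure : set (euclid R n.+1) -> \bar R :=
  pushforward (lebesgue_measure \x mu)%E consT.

Let cons_measure0 : cons_measure set0 = 0%E.
Proof. by rewrite /cons_measure /pushforward preimage_set0 measure0. Qed.

Let cons_measure_ge0 A : (0 <= cons_measure A)%E.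
Proof. by rewrite /cons_measure /pushforward measure_ge0. Qed.

Let cons_measure_sigma_additive : semi_sigma_additive cons_measure.
Proof.
move=> F mF tF mUF; rewrite /cons_measure /pushforward preimage_bigcup.
have mpre A : measurable A -> measurable (consT @^-1` A).
  by move=> mA; rewrite -[X in measurable X]setTI; exact: measurable_consT.
apply: measure_semi_sigma_additive.
- by move=> k; exact: mpre.
- apply/trivIsetP => /= i j _ _ ij; rewrite -preimage_setI.
  by move/trivIsetP : tF => /(_ _ _ _ _ ij) ->//; rewrite preimage_set0.
- by rewrite -preimage_bigcup; exact: mpre.
Qed.

HB.instance Definition _ := isMeasure.Build _ _ _
  cons_measure cons_measure0 cons_measure_ge0 cons_measure_sigma_additive.

Let cons_measure_sigma_finite : sigma_finite setT cons_measure.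
Proof.
have /sigma_finiteP[F [TF ndF Foo]] := sigma_finiteT (@lebesgue_measure R).
have /sigma_finiteP[G [TG ndG Goo]] := sigma_finiteT mu.
exists (fun k => unconsT @^-1` (F k `*` G k)).
  rewrite -preimage_bigcup (_ : \bigcup_k _ = setT) ?preimage_setT//.
  rewrite -setXTT TF TG predeqE => -[x y]; split.
    by move=> [k _ []]; split; exists k.
  move=> [/= [j _ Fjx] [k _ Gky]]; exists (maxn j k) => //; split.
    by move: x Fjx; exact/subsetPset/ndF/leq_maxl.
  by move: y Gky; exact/subsetPset/ndG/leq_maxr.
move=> k; have [mF Fkoo] := Foo k; have [mG Gkoo] := Goo k.
have mFG := measurableX mF mG; split.
  by rewrite -[X in measurable X]setTI; exact: measurable_unconsT.
rewrite /cons_measure /pushforward -comp_preimage (_ : _ \o _ = id); last first.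
  by apply/funext => p; exact: consTK.
by rewrite preimage_id product_measure1E// lte_mul_pinfty// ge0_fin_numE.
Qed.

HB.instance Definition _ := Measure_isSigmaFinite.Build _ _ _
  cons_measure cons_measure_sigma_finite.

End cons_measure.

(* Lebesgue measure on R^n: the n-fold product, moved to tuples by consT; R^0 is
   a point of mass 1. *)
Fixpoint lebesgue_tuple (R : realType) (n : nat) :
    {sigma_finite_measure set (euclid R n) -> \bar R} :=
  if n is n'.+1 then cons_measure (lebesgue_tuple R n') else dirac [tuple].

Section function_spaces.
Variables (R : realType) (d : nat).
Local Notation C := R[i].
Local Notation E := (euclid R d).
Implicit Types (f g : E -> C) (p : d.-tuple int) (t alpha : R).

Definition cube (a b : R) : set E :=
  [set x | forall i, (tnth x i : R) \in `[a, b]%R].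

Definition cintegral (D : set E) g : C :=
  (\int[lebesgue_tuple R d]_(x in D) complex.Re (g x))%R +i*
  (\int[lebesgue_tuple R d]_(x in D) complex.Im (g x))%R.

Definition trig p (x : E) : C :=
  let theta := 2 * pi * \sum_(j < d) (tnth p j)%:~R * (tnth x j : R) in
  cos theta +i* sin theta.

Definition fourier_coef f p : C :=
  cintegral (cube 0 1) (fun x => f x * (trig p x)^*).

Definition periodic f := forall p (x : E),
  f [tuple (tnth x j : R) + (tnth p j)%:~R | j < d] = f x.

Definition square_integrable f :=
  [/\ measurable_fun setT (fun x => complex.Re (f x)),
      measurable_fun setT (fun x => complex.Im (f x)) &
      (\int[lebesgue_tuple R d]_(x in cube 0 1) (normc (f x) ^+ 2)%:E < +oo)%E].

(* f is the unconditional sum of its Fourier series at every point.  For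
   functions with t-norm finite for some t > 1/2 the series converges
   absolutely, so this selects, in the L^2 class of f, the continuous
   representative, for which the pointwise sup norm is meaningful. *)
Definition fourier_expanded f := forall (x : E) (eps : R), 0 < eps ->
  exists A : {fset d.-tuple int}, forall B : {fset d.-tuple int},
    (A `<=` B)%fset ->
    normc (f x - \sum_(p <- B) fourier_coef f p * trig p x) < eps.

Definition mixed_weight t p : R :=
  \prod_(j < d) (1 + `|(tnth p j)%:~R|) `^ t.

Definition H_norm t f : \bar R :=
  ((\esum_(p in setT)
      (mixed_weight t p ^+ 2 * normc (fourier_coef f p) ^+ 2)%:E) `^ 2^-1)%E.

Definition A_norm t f : \bar R :=
  \esum_(p in setT) (mixed_weight t p * normc (fourier_coef f p))%:E.

Definition H_space t f :=
  [/\ periodic f, square_integrable f, fourier_expanded f &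
      (H_norm t f < +oo)%E].

(* For alpha < 0, powR gives the value 0 where 1 - x_i ^ 2 = 0: a null set. *)
Definition jacobi_weight alpha (x : E) : R :=
  \prod_(i < d) (1 - (tnth x i : R) ^+ 2) `^ alpha.

Definition weighted_L2_norm alpha g : \bar R :=
  ((\int[lebesgue_tuple R d]_(x in cube (-1) 1)
      (normc (g x) ^+ 2 * jacobi_weight alpha x)%:E) `^ 2^-1)%E.

Definition L2_norm g : \bar R :=
  ((\int[lebesgue_tuple R d]_(x in cube (-1) 1)
      (normc (g x) ^+ 2)%:E) `^ 2^-1)%E.

Definition sup_norm g : \bar R :=
  ereal_sup [set (normc (g x))%:E | x in cube (-1) 1].

(* P k is the orthonormal Jacobi polynomial of degree k with parameters
   (alpha, alpha); the sign of the leading coefficient, positive as in the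
   classical standardization, makes P unique. *)
Definition orthonormal_jacobi alpha (P : nat -> {poly R}) :=
  [/\ forall k, size (P k) = k.+1,
      forall k, 0 < lead_coef (P k) &
      forall j k,
        \int[lebesgue_measure]_(x in `[-1, 1])
          ((P j).[x] * (P k).[x] * (1 - x ^+ 2) `^ alpha) = (j == k)%:R].

(* k has entries at most N, which |k|_1 <= N forces anyway. *)
Definition admissible (N m : nat)
    (uk : {set 'I_d} * {ffun 'I_d -> 'I_N.+1}) : bool :=
  [&& (#|uk.1| <= m)%N,
      [forall j, (j \in uk.1) == (0 < uk.2 j)%N] &
      (\sum_(j < d) uk.2 j <= N)%N].

Definition jacobi_span (P : nat -> {poly R}) (N m : nat) : set (E -> C) :=
  [set g | exists c : {set 'I_d} * {ffun 'I_d -> 'I_N.+1} -> C,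
    forall x : E, g x = \sum_(uk | admissible m uk)
      c uk * (\prod_(i in uk.1) (P (uk.2 i)).[tnth x i])%:C].

Definition weighted_inner alpha f g : C :=
  cintegral (cube (-1) 1)
    (fun x => f x * (g x)^* * (jacobi_weight alpha x)%:C).

(* Elements of jacobi_span are polynomial functions, hence determined by their
   restriction to the cube, so at most one q qualifies. *)
Definition jacobi_projection alpha (P : nat -> {poly R}) (N m : nat) f
    : E -> C :=
  xget (cst 0) [set q | jacobi_span P N m q /\
    forall g, jacobi_span P N m g ->
      weighted_inner alpha (fun x => f x - q x) g = 0].

End function_spaces.

Definition D_const (R : realType) (N : nat) (alpha : R) : R :=
  if alpha == - 2^-1 then 2
  else pi `^ (3 / 4) * N%:R `^ (alpha + 2^-1) * expR (alpha + 3 / 4).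

(* Main.v *)
Require Import Defs.
From HB Require Import structures.
From mathcomp Require Import all_boot all_order all_algebra.
From mathcomp Require Import finmap.
From mathcomp Require Import complex.
From mathcomp Require Import all_classical all_reals all_analysis.
From mathcomp Require Import measurable_realfun.
From mathcomp Require Import ring lra zify.

Set Implicit Arguments.
Unset Strict Implicit.
Unset Printing Implicit Defensive.

Import Order.TTheory GRing.Theory Num.Theory.
Import numFieldNormedType.Exports.
Import ComplexField.Normc.

Local Open Scope classical_set_scope.
Local Open Scope complex_scope.
Local Open Scope ring_scope.

(* Since m <= d, the factor 2^(-t(m+1)), where t = s + d/2, is bounded below in
   terms of d and s, so the first term of each right-hand side already dominates
   the sum of the |a_p(f)|.  This gives the weighted bound, the projection being
   a contraction.  For the sup bound, split the Fourier series at |p|_oo = c N.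
   An exponential of frequency below c N is, up to O(e^(-cN)), a product of
   univariate Taylor polynomials of total degree at most N; the projection of
   such a product keeps its interaction terms of order at most m, which is
   bounded in sup norm independently of N.  On the remainder g, the bound
   sum_(k <= N) P_k^2 = O(N^(2 alpha + 2)) on [-1, 1] and Bessel's inequality give
   |Pi g|_oo = O(N^((alpha + 1) m)) |g|_oo, and Cauchy-Schwarz gives
   |g|_oo = O(N^(1/2 - t)) |f|_(H^t); since m >= 1, the product of the two is
   O(D^m r^(t - m)). *)

(** * Integration over the cube *)

(** Applying the kernel bound to all of f would lose a power of N on the low frequencies, whose
    contribution is not small; hence the explicit approximant Q. If Q has total degree at most N and
    T is its part of order at most m, then Pi f = T + Pi (f - Q). Bounding T is the delicate point,
    because truncation by interaction order is not a product operation. Once the set of active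
    coordinates is fixed, however, the sum factors over the coordinates: each factor is either the
    degree-0 component of a univariate polynomial, which is a weighted mean, or the polynomial minus
    that mean. There are at most 2^d such sets. The Taylor error e^(-n), with n = floor(N / d),
    beats every power of N. On the remainder the powers of N match because (alpha + 1) m + 1/2 - t
    <= (alpha + 1/2) m + m - t, with gap (m - 1) / 2. Since the basis is real, complex functions are
    treated through their real and imaginary parts. *)

Lemma integrable_prod_tuple (R : realType) (n : nat) (h : 'I_n -> R -> R) :
  (forall i, lebesgue_measure.-integrable setT (EFin \o h i)) ->
  (lebesgue_tuple R n).-integrable setT
     (fun x : euclid R n => (\prod_(i < n) h i (tnth x i))%:E) /\
  (\int[lebesgue_tuple R n]_x (\prod_(i < n) h i (tnth x i))%:E
    = (\prod_(i < n) \int[lebesgue_measure]_x h i x)%:E)%E.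
Proof.
elim: n h => [|n IH] h hi.
  rewrite big_ord0.
  have -> : (fun x : euclid R 0 => (\prod_(i < 0) h i (tnth x i))%:E) = cst 1%E.
    by apply/funext => x; rewrite big_ord0.
  split.
    apply/integrableP; split; first exact: measurable_cst.
    by rewrite /= (eq_integral (cst 1%E)) ?integral_dirac//= ?diracT ?mul1e ?ltry//
      => x _; rewrite normr1.
  by rewrite integral_dirac//= diracT mul1e.
pose g (x : euclid R n) := \prod_(i < n) h (lift ord0 i) (tnth x i).
have [gi gE] := IH (fun i => h (lift ord0 i)) (fun i => hi _).
(* [lebesgue_tuple] is built as the image of a product measure under [consT], so composing with
   [consT] isolates the first coordinate and Fubini separates it. *)
have prodE : (fun x : euclid R n.+1 => (\prod_(i < n.+1) h i (tnth x i))%:E)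
    \o @consT R n = fun z => (h ord0 z.1 * g z.2)%:E.
  apply/funext => -[x t]/=; rewrite big_ord_recl; congr (_ * _)%:E.
  by apply: eq_bigr => i _; rewrite tnthS.
have mh i : measurable_fun setT (h i).
  by have /measurable_int/measurable_EFinP := hi i.
have mg : measurable_fun setT g by have /measurable_int/measurable_EFinP := gi.
have mprod : measurable_fun setT
    (fun x : euclid R n.+1 => (\prod_(i < n.+1) h i (tnth x i))%:E).
  apply/measurable_EFinP; apply: measurable_prod => i _.
  exact: measurableT_comp (mh i) (measurable_tnth i).
have mhg : measurable_fun setT (fun z
  : measurableTypeR R * euclid R n => (h ord0 z.1 * g z.2)%:E).
  apply/measurable_EFinP; apply: measurable_funM.
    exact: measurableT_comp (mh ord0) measurable_fst.
  exact: measurableT_comp mg measurable_snd.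
have hgi : (lebesgue_measure \x lebesgue_tuple R n)%E.-integrable setT (fun z => (h
  ord0 z.1 * g z.2)%:E).
  apply/(integrable12ltyP _ _ mhg).
  under eq_integral => x _.
    under eq_integral => y _ do rewrite /= normrM EFinM.
    rewrite ge0_integralZl//; last first.
      by apply/measurable_EFinP; exact: (measurableT_comp (@normr_measurable R setT)
        mg).
    over.
  rewrite ge0_integralZr//=.
  - have /integrableP[_ h1] := hi ord0.
    have /integrableP[_ g1] := gi.
    rewrite lte_mul_pinfty//; first exact: integral_ge0.
    by rewrite ge0_fin_numE//; apply: integral_ge0.
  - by apply/measurable_EFinP; exact: (measurableT_comp (@normr_measurable R setT)
    (mh ord0)).
  - by apply: integral_ge0 => *; rewrite lee_fin.
have mc := @measurable_consT R n.
have D0 : (@consT R n) @^-1` setT = setT by [].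
split.
  by apply: (integrable_pushforward mc) => //; rewrite D0 prodE.
rewrite (integral_pushforward mc) ?D0 ?prodE//.
rewrite -integral12_prod_meas1// big_ord_recl EFinM -gE.
have E1 x : (\int[lebesgue_tuple R n]_y (h ord0 x * g y)%:E
    = (h ord0 x)%:E * \int[lebesgue_tuple R n]_y (g y)%:E)%E.
  by rewrite -integralZl.
rewrite /fubini_F; under eq_integral => x _ do rewrite E1.
have E0 : (\int[lebesgue_measure]_x (h ord0 x)%:E = (\int[lebesgue_measure]_x h ord0
  x)%:E)%E.
  by rewrite /Rintegral fineK//; apply: integrable_fin_num (hi ord0).
by rewrite gE integralZr// ?E0//; exact: hi.
Qed.

Lemma measurable_cube (R : realType) (d : nat) (a b : R) :
  measurable (cube a b : set (euclid R d)).
Proof.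
rewrite (_ : cube a b = \bigcap_(i in [set: 'I_d]) (fun x
  : euclid R d => tnth x i) @^-1` `[a, b]%classic).
  apply: fin_bigcap_measurable => // i _; rewrite -[X in measurable X]setTI.
  exact: (@measurable_tnth _ (measurableTypeR R) d i).
by apply/seteqP; split => x /= xab i => [_|]; have := xab i; rewrite /= in_itv/=; tauto.
Qed.

Lemma integrable_prod_cube (R : realType) (d : nat) (a b : R)
    (h : 'I_d -> R -> R) :
  (forall i, lebesgue_measure.-integrable `[a, b] (EFin \o h i)) ->
  (lebesgue_tuple R d).-integrable (cube a b)
     (fun x : euclid R d => (\prod_(i < d) h i (tnth x i))%:E) /\
  \int[lebesgue_tuple R d]_(x in cube a b) \prod_(i < d) h i (tnth x i)
    = \prod_(i < d) \int[lebesgue_measure]_(x in `[a, b]) h i x.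
Proof.
move=> hi.
have mab := @measurable_cube R d a b.
(* Extending each factor by 0 outside [a, b] makes the product vanish off the cube, which reduces
   the claim to the whole space. *)
have resE : (fun x : euclid R d => \prod_(i < d) (h i \_ `[a, b]) (tnth x i))
    = (fun x => \prod_(i < d) h i (tnth x i)) \_ (cube a b).
  apply/funext => x; rewrite patchE; case: ifPn => [/set_mem xab|].
    by apply: eq_bigr => i _; rewrite patchE mem_set//; exact: xab.
  rewrite notin_setE => /existsNP[i xi].
  by rewrite (bigD1 i)//= patchE memNset ?mul0r.
have [|pi pE] := @integrable_prod_tuple R d (fun i => h i \_ `[a, b]).
  move=> i; rewrite (_ : EFin \o _ = (EFin \o h i) \_ `[a, b]).
    by apply/integrable_restrict => //; rewrite setTI; exact: hi.
  by apply/funext => x; rewrite /= !patchE; case: ifP.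
have resE' : (fun x : euclid R d => (\prod_(i < d) (h i \_ `[a, b]) (tnth x i))%:E)
    = (fun x => (\prod_(i < d) h i (tnth x i))%:E) \_ (cube a b).
  apply/funext => x; have /(congr1 (fun f => f x)) /= -> := resE.
  by rewrite !patchE; case: ifP.
split.
  by move: pi; rewrite resE' => /integrable_restrict; rewrite setTI; exact.
rewrite /Rintegral integral_mkcond -resE' pE/=.
by apply: eq_bigr => i _; rewrite [RHS]Rintegral_mkcond.
Qed.

(** * Integration of bounded functions against the Jacobi weight *)

Definition ultraspherical_weight (R : realType) (alpha x : R) : R :=
  (1 - x ^+ 2) `^ alpha.

Lemma bounded_by (R : realType) (T : Type) (D : set T) (h : T -> R) (M : R) :
  (forall x, D x -> `|h x| <= M) -> [bounded h x | x in D].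
Proof.
move=> hM; rewrite /bounded_near; near=> M' => x /= Dx; apply: (le_trans (hM x Dx));
  near: M'.
by apply: nbhs_pinfty_ge; exact: num_real.
Unshelve. all: by end_near. Qed.

(** The bound is asked on the cube only, since polynomials are in general unbounded elsewhere. The
    class is closed under sums and products, and its members are integrable against an integrable
    weight. *)
Definition cube_bounded (R : realType) (d : nat) (h : euclid R d -> R) :=
  measurable_fun setT h /\
  exists M : R, forall x, cube (-1) 1 x -> `|h x| <= M.

Section cube_bounded_theory.
Variables (R : realType) (d : nat).
Implicit Types h g : euclid R d -> R.

Lemma cube_bounded_cst (c : R) : cube_bounded (fun _ : euclid R d => c).
Proof. by split; [exact: measurable_cst|exists `|c|]. Qed.

Lemma cube_boundedD h g :
  cube_bounded h -> cube_bounded g -> cube_bounded (fun x => h x + g x).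
Proof.
move=> [mh [M hM]] [mg [L gL]]; split; first exact: measurable_funD.
exists (M + L) => x cx; rewrite (le_trans (ler_normD _ _))//.
by rewrite lerD ?hM ?gL.
Qed.

Lemma cube_boundedM h g :
  cube_bounded h -> cube_bounded g -> cube_bounded (fun x => h x * g x).
Proof.
move=> [mh [M hM]] [mg [L gL]]; split; first exact: measurable_funM.
exists (M * L) => x cx; rewrite normrM.
by rewrite ler_pM ?hM ?gL.
Qed.

Lemma cube_boundedZ (c : R) h :
  cube_bounded h -> cube_bounded (fun x => c * h x).
Proof. by apply: cube_boundedM; exact: cube_bounded_cst. Qed.

Lemma cube_boundedB h g :
  cube_bounded h -> cube_bounded g -> cube_bounded (fun x => h x - g x).
Proof.
move=> bh bg; rewrite (_ : (fun x => _) = fun x => h x + (-1) * g x).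
  by apply: cube_boundedD => //; exact: cube_boundedZ.
by apply/funext => x; rewrite mulN1r.
Qed.

Lemma cube_bounded_sum (I : Type) (s : seq I) (p : pred I)
    (h : I -> euclid R d -> R) :
  (forall i, cube_bounded (h i)) ->
  cube_bounded (fun x => \sum_(i <- s | p i) h i x).
Proof.
move=> bh; elim: s => [|i s IH].
  by under eq_fun do rewrite big_nil; exact: cube_bounded_cst.
under eq_fun do rewrite big_cons.
by case: (p i) => //; exact: cube_boundedD.
Qed.

Lemma cube_bounded_prod (I : Type) (s : seq I) (p : pred I)
    (h : I -> euclid R d -> R) :
  (forall i, cube_bounded (h i)) ->
  cube_bounded (fun x => \prod_(i <- s | p i) h i x).
Proof.
move=> bh; elim: s => [|i s IH].
  by under eq_fun do rewrite big_nil; exact: cube_bounded_cst.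
under eq_fun do rewrite big_cons.
by case: (p i) => //; exact: cube_boundedM.
Qed.

Lemma cube_bounded_horner (p : {poly R}) (i : 'I_d) :
  cube_bounded (fun x : euclid R d => p.[tnth x i]).
Proof.
elim/poly_ind: p => [|p c IH].
  by under eq_fun do rewrite horner0; exact: cube_bounded_cst.
under eq_fun do rewrite hornerMXaddC.
apply: cube_boundedD; last exact: cube_bounded_cst.
apply: cube_boundedM => //; split; first exact: (@measurable_tnth _ (measurableTypeR
  R)).
by exists 1 => x /(_ i) /=; rewrite in_itv/= ler_norml.
Qed.

End cube_bounded_theory.

Lemma bounded_horner (R : realType) (p : {poly R}) :
  [bounded p.[x] | x in `[-1, 1]%classic].
Proof.
have [_ [M hM]] := @cube_bounded_horner R 1 p ord0.
apply: (@bounded_by _ _ _ _ M) => x; rewrite /= in_itv/= => x11.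
have := hM [tuple x]; rewrite (tnth_nth 0)/=; apply => j.
by rewrite (tnth_nth 0) ord1/= in_itv.
Qed.

Definition weighted_integral (R : realType) (alpha : R) (d : nat)
    (h : euclid R d -> R) : R :=
  \int[lebesgue_tuple R d]_(x in cube (-1) 1) (h x * jacobi_weight alpha x).

Section weighted_integral_theory.
Variables (R : realType) (alpha : R) (d : nat).
Hypothesis weight_integrable :
  lebesgue_measure.-integrable `[-1, 1] (EFin \o ultraspherical_weight alpha).
Implicit Types h g : euclid R d -> R.
Local Notation I := (weighted_integral alpha).

Lemma jacobi_weight_ge0 (x : euclid R d) : 0 <= jacobi_weight alpha x.
Proof. by apply: prodr_ge0 => i _; exact: powR_ge0. Qed.

Lemma integrable_weighted h : cube_bounded h ->
  (lebesgue_tuple R d).-integrable (cube (-1) 1)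
    (fun x => (h x * jacobi_weight alpha x)%:E).
Proof.
move=> [mh [M hM]].
have [wi _] := @integrable_prod_cube R d (-1) 1 (fun=> ultraspherical_weight alpha)
  (fun=> weight_integrable).
apply: (integrableMr (@measurable_cube R d (-1) 1) (measurable_funTS mh) _ wi).
exact: bounded_by hM.
Qed.

Lemma weighted_integralD h g : cube_bounded h -> cube_bounded g ->
  I (fun x => h x + g x) = I h + I g.
Proof.
move=> bh bg; rewrite /weighted_integral -RintegralD ?integrable_weighted//;
  last exact: measurable_cube.
by apply: eq_Rintegral => x _; rewrite mulrDl.
Qed.

Lemma weighted_integralZ (c : R) h : cube_bounded h ->
  I (fun x => c * h x) = c * I h.
Proof.
move=> bh; rewrite /weighted_integral -RintegralZl ?integrable_weighted//;
  last exact: measurable_cube.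
by apply: eq_Rintegral => x _; rewrite mulrA.
Qed.

Lemma weighted_integral_sum (T : Type) (s : seq T) (p : pred T)
    (h : T -> euclid R d -> R) : (forall i, cube_bounded (h i)) ->
  I (fun x => \sum_(i <- s | p i) h i x) = \sum_(i <- s | p i) I (h i).
Proof.
move=> bh; elim: s => [|i s IH].
  under eq_fun do rewrite big_nil; rewrite big_nil.
  rewrite -[in RHS](mul0r (I (fun _ : euclid R d => 0))) -weighted_integralZ;
    last exact: cube_bounded_cst.
  by congr (weighted_integral _ _); apply/funext => x; rewrite mul0r.
under eq_fun do rewrite big_cons; rewrite big_cons.
case: (p i) => //; rewrite weighted_integralD// ?IH//.
exact: cube_bounded_sum.
Qed.

Lemma weighted_integral_ge0 h : (forall x, 0 <= h x) -> 0 <= I h.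
Proof.
by move=> h0; apply: Rintegral_ge0 => x _; rewrite mulr_ge0 ?jacobi_weight_ge0.
Qed.

Lemma le_weighted_integral h g : cube_bounded h -> cube_bounded g ->
  (forall x, cube (-1) 1 x -> h x <= g x) -> I h <= I g.
Proof.
move=> bh bg hg; apply: le_Rintegral.
- exact: measurable_cube.
- exact: integrable_weighted.
- exact: integrable_weighted.
- by move=> x cx; rewrite ler_wpM2r ?jacobi_weight_ge0 ?hg.
Qed.

Lemma weighted_integral_prod (p : 'I_d -> {poly R}) :
  I (fun x => \prod_(i < d) (p i).[tnth x i])
  = \prod_(i < d) \int[lebesgue_measure]_(x in `[-1, 1])
      ((p i).[x] * (1 - x ^+ 2) `^ alpha).
Proof.
have [|_ <-] := @integrable_prod_cube R d (-1) 1
    (fun i x => (p i).[x] * ultraspherical_weight alpha x).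
  move=> i; apply: (integrableMr _ _ _ weight_integrable) => //.
    exact: measurable_poly.
  exact: bounded_horner.
by apply: eq_Rintegral => x _; rewrite -big_split.
Qed.

Lemma weighted_integral_cst (c : R) :
  I (fun _ : euclid R d => c)
  = c * (\int[lebesgue_measure]_(x in `[-1, 1]) (1 - x ^+ 2) `^ alpha) ^+ d.
Proof.
rewrite -[in LHS](mulr1 c) weighted_integralZ; last exact: cube_bounded_cst.
congr (_ * _).
have := weighted_integral_prod (fun=> 1).
under eq_fun do under eq_bigr do rewrite hornerC; rewrite big1//.
under [in RHS]eq_bigr do under eq_Rintegral do rewrite hornerC mul1r.
by rewrite prodr_const card_ord.
Qed.

End weighted_integral_theory.

(** Pythagoras for h = (h - g) + g: the cross term vanishes because g is a combination of the
    [Phi k] to which h - g is orthogonal. Dropping one square or the other gives Bessel's inequality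
    and the contraction property. *)
Lemma weighted_bessel (R : realType) (alpha : R) (d : nat)
    (T : finType) (A : pred T) (Phi : T -> euclid R d -> R) (b : T -> R)
    (h : euclid R d -> R) :
  lebesgue_measure.-integrable `[-1, 1] (EFin \o ultraspherical_weight alpha) ->
  (forall k, cube_bounded (Phi k)) ->
  (forall k l, weighted_integral alpha (fun x => Phi k x * Phi l x) = (k == l)%:R) ->
  cube_bounded h ->
  let g x := \sum_(k | A k) b k * Phi k x in
  (forall k, A k -> weighted_integral alpha (fun x => (h x - g x) * Phi k x) = 0) ->
  \sum_(k | A k) b k ^+ 2 <= weighted_integral alpha (fun x => h x ^+ 2) /\
  weighted_integral alpha (fun x => (h x - g x) ^+ 2)
    <= weighted_integral alpha (fun x => h x ^+ 2).
Proof.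
move=> wi bPhi ortho bh g hg0.
have bg : cube_bounded g by apply: cube_bounded_sum => k; exact: cube_boundedZ.
have bhg : cube_bounded (fun x => h x - g x) by exact: cube_boundedB.
have expand u : cube_bounded u ->
    weighted_integral alpha (fun x => u x * g x)
    = \sum_(k | A k) b k * weighted_integral alpha (fun x => u x * Phi k x).
  move=> bu; rewrite (_ : (fun x => _) = fun x => \sum_(k | A k) b k * (u x * Phi k x)).
    rewrite weighted_integral_sum//.
      by apply: eq_bigr => k _; rewrite weighted_integralZ//; exact: cube_boundedM.
    by move=> k; apply: cube_boundedZ; exact: cube_boundedM.
  by apply/funext => x; rewrite mulr_sumr; apply: eq_bigr => k _; rewrite mulrCA.
have gPhi k : A k -> weighted_integral alpha (fun x => g x * Phi k x) = b k.
  move=> Ak; under eq_fun do rewrite mulrC.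
  rewrite expand// (bigD1 k)//= ortho eqxx mulr1 big1 ?addr0// => l /andP[_ lk].
  by rewrite ortho eq_sym (negbTE lk) mulr0.
have gg : weighted_integral alpha (fun x => g x ^+ 2) = \sum_(k | A k) b k ^+ 2.
  by rewrite [LHS]expand//; apply: eq_bigr => k Ak; rewrite gPhi.
have cross : weighted_integral alpha (fun x => (h x - g x) * g x) = 0.
  by rewrite expand// big1// => k Ak; rewrite hg0 ?mulr0.
have bsq u : cube_bounded u -> cube_bounded (fun x => u x ^+ 2).
  by move=> bu; exact: cube_boundedM.
have pyth : weighted_integral alpha (fun x => h x ^+ 2)
    = weighted_integral alpha (fun x => (h x - g x) ^+ 2)
      + \sum_(k | A k) b k ^+ 2.
  rewrite (_ : (fun x => h x ^+ 2) = fun x => ((h x - g x) ^+ 2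
    + 2 * ((h x - g x) * g x)) + g x ^+ 2); last first.
    by apply/funext => x; ring.
  rewrite weighted_integralD//; last first.
  - exact: bsq.
  - apply: cube_boundedD; first exact: bsq.
    by apply: cube_boundedZ; exact: cube_boundedM.
  rewrite weighted_integralD//; last first.
  - by apply: cube_boundedZ; exact: cube_boundedM.
  - exact: bsq.
  by rewrite weighted_integralZ ?cross ?mulr0 ?addr0 ?gg//; exact: cube_boundedM.
rewrite pyth; split.
  by rewrite lerDr weighted_integral_ge0// => x; exact: sqr_ge0.
by rewrite lerDl sumr_ge0// => k _; exact: sqr_ge0.
Qed.

(** * Growth of the Jacobi polynomials on [-1, 1] *)

(** Even trigonometric polynomials of degree at most N: the form taken by polynomials of degree at
    most N under x = cos theta. *)
Definition cosine_sum (R : realType) (N : nat) (T : R -> R) :=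
  exists a : nat -> R, forall x, T x = \sum_(k < N.+1) a k * cos (k%:R * x).

Lemma cosine_sumD (R : realType) N (S T : R -> R) :
  cosine_sum N S -> cosine_sum N T -> cosine_sum N (fun x => S x + T x).
Proof.
move=> [a Sa] [b Tb]; exists (fun k => a k + b k) => x.
by rewrite Sa Tb -big_split; apply: eq_bigr => k _ /=; rewrite -mulrDl.
Qed.

Lemma cosine_sumZ (R : realType) N (c : R) (T : R -> R) :
  cosine_sum N T -> cosine_sum N (fun x => c * T x).
Proof.
move=> [b Tb]; exists (fun k => c * b k) => x.
by rewrite Tb mulr_sumr; apply: eq_bigr => k _; rewrite mulrA.
Qed.

Lemma cosine_sum_cos (R : realType) (N k : nat) : (k <= N)%N ->
  cosine_sum N (fun x : R => cos (k%:R * x)).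
Proof.
move=> kN; exists (fun j => (j == k)%:R) => x.
have kN1 : (k < N.+1)%N by [].
rewrite (bigD1 (Ordinal kN1))//= eqxx mul1r big1 ?addr0// => j.
by rewrite -val_eqE/= => /negbTE ->; rewrite mul0r.
Qed.

Lemma cosine_sum_sum (R : realType) N (I : Type) (s : seq I) (p : pred I) (T : I
  -> R -> R) :
  (forall i, p i -> cosine_sum N (T i)) ->
  cosine_sum N (fun x => \sum_(i <- s | p i) T i x).
Proof.
move=> pT; elim: s => [|i s IH].
  exists (fun=> 0) => x; rewrite big_nil big1// => k _; exact: mul0r.
under eq_fun do rewrite big_cons.
by case: (boolP (p i)) => // pi; apply: cosine_sumD => //; exact: pT.
Qed.

(** Product-to-sum: cos x cos(kx) is the half-sum of the frequencies k + 1 and k - 1. Frequency 0 is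
    separate, as k - 1 would leave the naturals. *)
Lemma cosine_sumMcos (R : realType) N (T : R -> R) :
  cosine_sum N T -> cosine_sum N.+1 (fun x => cos x * T x).
Proof.
move=> [a Ta]; rewrite (_ : (fun x => _) = fun x => \sum_(k < N.+1) a k * (cos x
  * cos (k%:R * x))); last first.
  by apply/funext => x; rewrite Ta mulr_sumr; apply: eq_bigr => k _; rewrite mulrCA.
apply: cosine_sum_sum => -[k kN] _; apply: cosine_sumZ => /=.
case: k kN => [|k] kN.
  rewrite (_ : (fun x => _) = fun x => cos (1%:R * x)).
    exact: cosine_sum_cos.
  by apply/funext => x; rewrite mul0r cos0 mul1r mulr1.
rewrite (_ : (fun x => _) = fun x => 2^-1 * (cos (k.+2%:R * x) + cos (k%:R * x))).
  by apply/cosine_sumZ/cosine_sumD; apply: cosine_sum_cos; lia.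
apply/funext => x.
have -> : k.+2%:R * x = k.+1%:R * x + x by rewrite -[k.+2]addn1 natrD; ring.
have -> : k%:R * x = k.+1%:R * x - x by rewrite -[k.+1]addn1 natrD; ring.
by rewrite cosD cosB; field.
Qed.

Lemma cosine_sum_horner (R : realType) N (q : {poly R}) : (size q <= N.+1)%N ->
  cosine_sum N (fun x => q.[cos x]).
Proof.
elim: N q => [|N IH] q sq.
  exists (fun=> q`_0) => x.
  by rewrite (size1_polyC sq) hornerC big_ord1 mul0r cos0 mulr1 coefC.
have [p [c [qE sp]]] : exists p c, q = p * 'X + c%:P /\ (size p <= N.+1)%N.
  move: sq; elim/poly_ind: q => [|p c _] sq.
    by exists 0, 0; rewrite mul0r addr0 size_poly0.
  exists p, c; split => //; move: sq; rewrite size_MXaddC.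
  by case: ifP => // /andP[/eqP -> _] _; rewrite size_poly0.
rewrite (_ : (fun x => _) = fun x => cos x * p.[cos x] + c * cos (0%:R * x)).
  apply: cosine_sumD; first exact/cosine_sumMcos/IH.
  by apply: cosine_sumZ; exact: cosine_sum_cos.
by apply/funext => x; rewrite qE hornerMXaddC mul0r cos0 mulr1 mulrC.
Qed.

Lemma continuous_itv_integrable (R : realType) (f : R -> R) (a b : R) :
  continuous f -> lebesgue_measure.-integrable `[a, b] (EFin \o f).
Proof.
move=> cf; apply: continuous_compact_integrable; first exact: segment_compact.
exact: continuous_subspaceT.
Qed.

Lemma continuous_cosM (R : realType) (c : R) : continuous (fun x : R => cos (c * x)).
Proof.
move=> x; apply: continuous_comp; last exact: continuous_cos.
by apply: cvgM; [exact: cvg_cst|exact: cvg_id].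
Qed.

Lemma Rintegral_cos (R : realType) (n : nat) :
  \int[lebesgue_measure]_(x in `[0, pi]) cos (n%:R * x) = pi * (n == 0%N)%:R :> R.
Proof.
case: n => [|n].
  under eq_Rintegral do rewrite mul0r cos0.
  rewrite Rintegral_cst//= lebesgue_measure_itv/= lte_fin pi_gt0.
  by rewrite -EFinD/= subr0 mul1r mulr1.
have dsin (x : R) : is_derive x 1 (fun y
  : R => n.+1%:R^-1 * sin (n.+1%:R * y)) (cos (n.+1%:R * x)).
  have d1 : is_derive x 1 (fun y : R => n.+1%:R * y) (n.+1%:R).
    have := is_deriveZ n.+1%:R (is_derive_id x (1 : R)).
    by rewrite /GRing.scale/= mulr1.
  have d2 : is_derive x 1 (sin \o (fun y
    : R => n.+1%:R * y)) (n.+1%:R * cos (n.+1%:R * x)).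
    by rewrite mulrC; exact: is_derive1_comp.
  have := is_deriveZ n.+1%:R^-1 d2.
  by rewrite /GRing.scale/= mulKf.
rewrite mulr0 /Rintegral.
rewrite (@continuous_FTC2 _ _ (fun y => n.+1%:R^-1 * sin (n.+1%:R * y))) ?pi_gt0//.
- rewrite mulr0 sin0 mulr0 sube0/=.
  suff -> : sin (n.+1%:R * pi) = 0 :> R by rewrite mulr0.
  elim: n.+1 => [|k IH]; first by rewrite mul0r sin0.
  by rewrite -addn1 natrD mulrDl mul1r sinDpi IH oppr0.
- exact/continuous_subspaceT/continuous_cosM.
- have cF : continuous (fun y : R => n.+1%:R^-1 * sin (n.+1%:R * y)).
    by move=> x; apply/differentiable_continuous/derivable1_diffP/ex_derive.
  split.
  + by move=> x _; exact/ex_derive.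
  + exact/cvg_at_right_filter/cF.
  + exact/cvg_at_left_filter/cF.
- by move=> x _; rewrite derive1E; exact: derive_val.
Qed.

Lemma Cauchy_Schwarz_sum (R : realFieldType) (I : Type) (s : seq I) (p : pred I)
    (a b : I -> R) :
  (\sum_(i <- s | p i) a i * b i) ^+ 2
    <= (\sum_(i <- s | p i) a i ^+ 2) * (\sum_(i <- s | p i) b i ^+ 2).
Proof.
set A := \sum_(i <- s | p i) a i ^+ 2; set B := \sum_(i <- s | p i) b i ^+ 2.
set C := \sum_(i <- s | p i) a i * b i.
have quad t : 0 <= A + 2 * t * C + t ^+ 2 * B.
  rewrite /A /B /C !mulr_sumr -!big_split/=; apply: sumr_ge0 => i _.
  rewrite (_ : _ + _ = (a i + t * b i) ^+ 2); first exact: sqr_ge0.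
  by ring.
have B0 : 0 <= B by apply: sumr_ge0 => i _; exact: sqr_ge0.
have [B00|Bn0] := eqVneq B 0; last first.
  have Bp : 0 < B by rewrite lt0r Bn0.
  have := quad (- C / B).
  rewrite (_ : _ + _ = (A * B - C ^+ 2) / B); last by field.
  by rewrite ler_pdivlMr// mul0r subr_ge0.
rewrite B00 mulr0.
have [->|Cn0] := eqVneq C 0; first by rewrite expr0n.
(* With B = 0 the quadratic is affine in t, and this t gives it the value -1. *)
have := quad (- (A + 1) / (2 * C)).
rewrite B00 mulr0 addr0 (_ : _ + _ = -1); last by field.
by rewrite oppr_ge0 ler10.
Qed.

Lemma continuous_sum (R : realType) (I : Type) (s : seq I) (p : pred I) (f : I
  -> R -> R) :
  (forall i, continuous (f i)) -> continuous (fun x => \sum_(i <- s | p i) f i x).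
Proof.
move=> cf; elim: s => [|i s IH].
  by under eq_fun do rewrite big_nil; move=> x; exact: cvg_cst.
under eq_fun do rewrite big_cons.
by case: (p i) => // x; apply: cvgD; [exact: cf|exact: IH].
Qed.

Lemma continuousMf (R : realType) (f g : R -> R) :
  continuous f -> continuous g -> continuous (fun x => f x * g x).
Proof. by move=> cf cg x; apply: cvgM; [exact: cf|exact: cg]. Qed.

Lemma Rintegral_itv_sum (R : realType) (a b : R) (I : Type) (s : seq I) (p
  : pred I) (f : I -> R -> R) :
  (forall i, continuous (f i)) ->
  \int[lebesgue_measure]_(x in `[a, b]) (\sum_(i <- s | p i) f i x)
  = \sum_(i <- s | p i) \int[lebesgue_measure]_(x in `[a, b]) f i x.
Proof.
move=> cf; elim: s => [|i s IH].
  under eq_Rintegral do rewrite big_nil.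
  by rewrite big_nil Rintegral_cst ?mul0r//; exact: measurable_itv.
under eq_Rintegral do rewrite big_cons; rewrite big_cons.
case: (p i) => //; rewrite RintegralD ?IH//.
  exact: continuous_itv_integrable.
by apply: continuous_itv_integrable; exact: continuous_sum.
Qed.

(** The second indicator adds the extra pi / 2 at k = l = 0, where the integrand is 1. Ordering k
    and l first makes the natural subtraction k - l a true difference. *)
Lemma Rintegral_cosMcos (R : realType) (k l : nat) :
  \int[lebesgue_measure]_(x in `[0, pi]) (cos (k%:R * x) * cos (l%:R * x))
  = pi / 2 * ((k == l)%:R + (k + l == 0)%N%:R) :> R.
Proof.
wlog kl : k l / (l <= k)%N.
  move=> H; have /orP[kl|lk] := leq_total l k; first exact: H.
  rewrite eq_sym addnC -H//.
  by apply: eq_Rintegral => x _; rewrite mulrC.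
transitivity (\int[lebesgue_measure]_(x in `[0,
  pi]) (2^-1 * (cos ((k - l)%N%:R * x) + cos ((k + l)%N%:R * x))) : R).
  apply: eq_Rintegral => x _.
  by rewrite natrB// natrD mulrBl mulrDl cosB cosD; field.
have ci c := @continuous_itv_integrable R _ 0 pi (@continuous_cosM R c).
rewrite RintegralZl//; last first.
  apply: continuous_itv_integrable => x.
  by apply: cvgD; exact: continuous_cosM.
rewrite RintegralD// !Rintegral_cos.
have -> : (k - l == 0)%N = (k == l) by rewrite subn_eq0 eqn_leq kl andbT.
by field.
Qed.

Lemma cosine_sum_continuous (R : realType) N (T : R -> R) : cosine_sum N T
  -> continuous T.
Proof.
move=> [a Ta]; rewrite (_ : T = fun x => \sum_(k < N.+1) a k * cos (k%:R * x));
  last exact/funext.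
apply: continuous_sum => i; apply: continuousMf; last exact: continuous_cosM.
by move=> x; exact: cvg_cst.
Qed.

(** Cauchy-Schwarz bounds T(x)^2 by N + 1 times the sum of the a_k^2, and Parseval bounds that sum
    by 2 / pi times the integral; the constant mode counts double there, which only helps. *)
Lemma cosine_sum_sup (R : realType) N (T : R -> R) (x : R) : cosine_sum N T ->
  T x ^+ 2 <= N.+1%:R * (2 / pi) * \int[lebesgue_measure]_(y in `[0, pi]) (T y ^+ 2).
Proof.
move=> [a Ta].
have cT k : continuous (fun y : R => a k * cos (k%:R * y)).
  apply: continuousMf; last exact: continuous_cosM.
  by move=> y; exact: cvg_cst.
have intT : \int[lebesgue_measure]_(y in `[0, pi]) (T y ^+ 2)
    = \sum_(k < N.+1) a k ^+ 2 * (pi / 2 * (1 + (k + k == 0)%N%:R)).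
  transitivity (\int[lebesgue_measure]_(y in `[0, pi])
      \sum_(k < N.+1) \sum_(l < N.+1) a k * a l * (cos (k%:R * y) * cos (l%:R * y))).
    apply: eq_Rintegral => y _; rewrite Ta expr2 mulr_suml; apply: eq_bigr => k _.
    by rewrite mulr_sumr; apply: eq_bigr => l _; ring.
  have cc (k l : nat) : continuous (fun y
    : R => a k * a l * (cos (k%:R * y) * cos (l%:R * y))).
    apply: continuousMf; first by move=> y; exact: cvg_cst.
    by apply: continuousMf; exact: continuous_cosM.
  rewrite Rintegral_itv_sum => [|k]; last exact: continuous_sum.
  apply: eq_bigr => k _; rewrite Rintegral_itv_sum//.
  rewrite (bigD1 k)//= [X in _ + X]big1 ?addr0 => [|l lk].
    rewrite RintegralZl//; last first.
      by apply: continuous_itv_integrable; apply: continuousMf; exact: continuous_cosM.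
    by rewrite Rintegral_cosMcos eqxx expr2.
  rewrite RintegralZl//; last first.
    by apply: continuous_itv_integrable; apply: continuousMf; exact: continuous_cosM.
  rewrite Rintegral_cosMcos (_ : (k == l :> nat) = false); last first.
    by apply/negbTE; rewrite eq_sym.
  rewrite (_ : (k + l == 0)%N = false) ?addr0 ?mulr0//.
  by apply/negbTE; move: lk; rewrite -val_eqE/= addn_eq0;
    case: (val k) (val l) => [|?] [|?].
have p0 := pi_gt0 R.
have low : pi / 2 * \sum_(k < N.+1) a k ^+ 2 <= \int[lebesgue_measure]_(y in `[0,
  pi]) (T y ^+ 2).
  rewrite intT mulr_sumr; apply: ler_sum => k _.
  rewrite mulrC ler_wpM2l ?sqr_ge0// ler_peMr ?lerDl//.
  by rewrite divr_ge0// ltW.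
have cs : T x ^+ 2 <= N.+1%:R * \sum_(k < N.+1) a k ^+ 2.
  rewrite Ta mulrC (le_trans (Cauchy_Schwarz_sum _ _ _ _))//.
  rewrite ler_wpM2l ?sumr_ge0// => [k _|]; first exact: sqr_ge0.
  rewrite -[leRHS]mulr1 -[in leRHS](card_ord N.+1) mulr_natl -sumr_const ler_sum//.
rewrite (le_trans cs)// -mulrA ler_wpM2l// -ler_pdivrMl; last by rewrite divr_gt0.
by rewrite invf_div.
Qed.

(** Serves to bound sin(pi / (8 (N + 1))) from below by sin(pi / 8) / (N + 1). *)
Lemma normr_sin_nat_le (R : realType) (n : nat) (x : R) :
  `|sin (n%:R * x)| <= n%:R * `|sin x|.
Proof.
elim: n => [|n IH]; first by rewrite !mul0r sin0 normr0.
rewrite -[n.+1]addn1 natrD !mulrDl !mul1r sinD (le_trans (ler_normD _ _))//.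
rewrite !normrM lerD//.
  rewrite (le_trans _ IH)// ler_piMr//.
  by rewrite ler_norml cos_geN1 cos_le1.
by rewrite ler_piMl// ler_norml cos_geN1 cos_le1.
Qed.

(** The weight times the Jacobian of x = cos theta. The new exponent is nonnegative exactly when
    alpha >= -1/2. *)
Lemma powR_sin_le (R : realType) (alpha x : R) : 0 < sin x ->
  (1 - cos x ^+ 2) `^ alpha * sin x = sin x `^ (2 * alpha + 1).
Proof.
move=> s0; rewrite -sin2cos2 powRD; last by rewrite (gt_eqF s0) implybT.
by rewrite powRr1 ?ltW// -powR_mulrn ?ltW// -powRrM.
Qed.

Lemma continuous_horner (R : realType) (q : {poly R}) : continuous (fun x : R => q.[x]).
Proof.
elim/poly_ind: q => [|p c IH].
  by under eq_fun do rewrite horner0; move=> x; exact: cvg_cst.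
under eq_fun do rewrite hornerMXaddC.
by move=> x; apply: cvgD; [apply: cvgM; [exact: IH|exact: cvg_id]|exact: cvg_cst].
Qed.

Lemma continuous_powR (R : realType) (alpha x : R) : 0 < x ->
  {for x, continuous (fun y : R => y `^ alpha)}.
Proof.
move=> /(is_derive1_powR alpha) dp.
exact/differentiable_continuous/derivable1_diffP/ex_derive.
Qed.

Lemma continuous_ultraspherical_weight (R : realType) (alpha x : R) : 0 < 1 - x ^+ 2 ->
  {for x, continuous (ultraspherical_weight alpha)}.
Proof.
move=> x0.
have c1 : {for x, continuous (fun y : R => 1 - y ^+ 2)}.
  apply: cvgB; first exact: cvg_cst.
  by apply: cvgM; exact: cvg_id.
exact: continuous_comp c1 (continuous_powR x0).
Qed.

(** The margin delta keeps x away from -1 and 1, where the weight is discontinuous if alpha < 0; the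
    change of variables needs a continuous integrand on the closed interval. *)
Lemma integral_cos_substitution (R : realType) (alpha delta : R) (q : {poly R}) :
  0 < delta -> delta < pi / 2 ->
  \int[lebesgue_measure]_(x in `[cos (pi - delta), cos delta])
     (q.[x] ^+ 2 * (1 - x ^+ 2) `^ alpha)
  = \int[lebesgue_measure]_(x in `[delta, pi - delta])
     (q.[cos x] ^+ 2 * sin x `^ (2 * alpha + 1)).
Proof.
move=> d0 dpi.
have ab : delta <= pi - delta by lra.
have sub : {subset `[delta, (pi - delta)] <= `[0, pi]}.
  by move=> x; rewrite !in_itv/= => /andP[? ?]; apply/andP; split; lra.
have cosE : (@cos R)^`()%classic = (fun x => - sin x).
  by apply/funext => x; rewrite derive1E; exact: derive_val.
have cN : continuous (fun x : R => - sin x).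
  by move=> x; apply: cvgN; exact: continuous_sin.
rewrite /Rintegral.
rewrite (@integration_by_substitution_decreasing _ cos
   (fun x => q.[x] ^+ 2 * (1 - x ^+ 2) `^ alpha))//.
- congr fine; apply: eq_integral => x /set_mem/=; rewrite in_itv/= => /andP[x1 x2].
  congr (_%:E); rewrite cosE fctE/= opprK -mulrA powR_sin_le//.
  by apply: sin_gt0_pi; apply/andP; split; lra.
- by move=> x y xI yI xy; rewrite ltr_cos// sub.
- by rewrite cosE => x _; exact: cN.
- by rewrite cosE; apply/cvg_ex; exists (- sin delta); apply/cvg_at_right_filter/cN.
- by rewrite cosE; apply/cvg_ex; exists (- sin (pi - delta));
  apply/cvg_at_left_filter/cN.
- split.
  + by move=> x _; exact: derivable_cos.
  + exact/cvg_at_right_filter/continuous_cos.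
  + exact/cvg_at_left_filter/continuous_cos.
- apply: continuous_in_subspaceT => x /set_mem/=; rewrite in_itv/= => /andP[x1 x2].
  apply: cvgM; first by apply: cvgM; exact: continuous_horner.
  apply: continuous_ultraspherical_weight.
  have c1 : cos delta < 1.
    by rewrite -(@cos0 R) ltr_cos ?in_itv/=; try (apply/andP; split); lra.
  have c2 : -1 < cos (pi - delta).
    by rewrite -(@cospi R) ltr_cos ?in_itv/=; try (apply/andP; split); lra.
  nra.
Qed.

Lemma ge0_subset_Rintegral (R : realType) (f : R -> R) (A B : set R) :
  measurable A -> measurable B -> lebesgue_measure.-integrable B (EFin \o f) ->
  (forall x, 0 <= f x) -> A `<=` B ->
  \int[lebesgue_measure]_(x in A) f x <= \int[lebesgue_measure]_(x in B) f x.
Proof.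
move=> mA mB fB f0 AB; rewrite /Rintegral fine_le//.
- by apply: integrable_fin_num => //; exact: integrableS fB.
- exact: integrable_fin_num.
- apply: ge0_subset_integral => //; last by move=> x _; rewrite lee_fin.
  exact: measurable_int fB.
Qed.

Lemma Rintegral_itv_le_cst (R : realType) (f : R -> R) (a b c : R) : a <= b ->
  continuous f -> (forall x, f x <= c) ->
  \int[lebesgue_measure]_(x in `[a, b]) f x <= c * (b - a).
Proof.
move=> ab cf fc.
have -> : c * (b - a) = \int[lebesgue_measure]_(x in `[a, b]) c.
  rewrite Rintegral_cst//= lebesgue_measure_itv/= lte_fin.
  by move: ab; rewrite le_eqVlt => /predU1P[->|->]; rewrite ?ltxx ?subrr.
apply: le_Rintegral => //; first exact: continuous_itv_integrable.
by apply: continuous_itv_integrable => x; exact: cvg_cst.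
Qed.

Lemma Rintegral_itv_split (R : realType) (f : R -> R) (a c b : R) : a <= c -> c <= b ->
  continuous f ->
  \int[lebesgue_measure]_(x in `[a, b]) f x
  = \int[lebesgue_measure]_(x in `[a, c]) f x
    + \int[lebesgue_measure]_(x in `[c, b]) f x.
Proof.
move=> ac cb cf.
have /(_ (BLeft a) (BRight b) c) := @Rintegral_itvB R f.
move=> /(_ (@continuous_itv_integrable R f a b cf)); rewrite !bnd_simp => /(_ ac cb) H.
suff -> : \int[lebesgue_measure]_(x in `[c, b]) f x
    = \int[lebesgue_measure]_(x in `]c, b]) f x by rewrite -H addrC subrK.
rewrite -Rintegral_itv_obnd_cbnd//.
have := @continuous_itv_integrable R f c b cf; apply: integrableS => //.
by apply: subset_itvr; rewrite bnd_simp.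
Qed.

(* The square of a cosine polynomial of degree N is at most O(N) times its mean,
   so the arcs of length O(1/N) around 0 and pi carry at most half of its
   integral; away from them the weight sin^(2 alpha + 1) is bounded below. *)
Lemma nikolskii (R : realType) (alpha : R) : - 2^-1 <= alpha ->
  exists2 C : R, 0 < C & forall (N : nat) (q : {poly R}) (x : R),
    (size q <= N.+1)%N -> -1 <= x <= 1 ->
    lebesgue_measure.-integrable `[-1, 1] (EFin \o ultraspherical_weight alpha) ->
    q.[x] ^+ 2 <= C * N.+1%:R `^ (2 * alpha + 2) *
      \int[lebesgue_measure]_(y in `[-1, 1]) (q.[y] ^+ 2 * (1 - y ^+ 2) `^ alpha).
Proof.
move=> ha; have p0 := pi_gt0 R.
pose sigma : R := sin (pi / 8).
have sigma0 : 0 < sigma by apply: sin_gt0_pi; apply/andP; split; lra.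
(* 4 / pi is the 2 / pi of [cosine_sum_sup] times the 2 lost by discarding the two arcs. *)
exists (4 / pi * sigma `^ (- (2 * alpha + 1))).
  by rewrite mulr_gt0 ?powR_gt0// divr_gt0.
move=> N q x sq x11 wi.
have N1 : 1 <= N.+1%:R :> R by rewrite ler1n.
have N0 : 0 < N.+1%:R :> R by [].
pose T y := q.[cos y].
have cosT : cosine_sum N T by exact: cosine_sum_horner.
have cT := cosine_sum_continuous cosT.
have cT2 : continuous (fun y => T y ^+ 2) by exact: continuousMf.
pose J := \int[lebesgue_measure]_(y in `[0, pi]) (T y ^+ 2).
have J0 : 0 <= J by apply: Rintegral_ge0 => y _; exact: sqr_ge0.
have supT y : T y ^+ 2 <= N.+1%:R * (2 / pi) * J by exact: cosine_sum_sup.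
(* Chosen so that each of the two arcs carries at most (N + 1) (2 / pi) J delta = J / 4. *)
pose delta : R := pi / (8 * N.+1%:R).
have d0 : 0 < delta by rewrite divr_gt0// mulr_gt0.
have d8 : delta <= pi / 8.
  by rewrite ler_pM2l// lef_pV2 ?posrE ?mulr_gt0//; lra.
pose Jm := \int[lebesgue_measure]_(y in `[delta, pi - delta]) (T y ^+ 2).
have JJm : J <= 2 * Jm.
  have : J <= N.+1%:R * (2 / pi) * J * (delta - 0) + (Jm
    + N.+1%:R * (2 / pi) * J * (pi - (pi - delta))).
    rewrite [leLHS](@Rintegral_itv_split _ _ _ delta)//; [|lra|lra].
    rewrite lerD//; first by apply: Rintegral_itv_le_cst => //; lra.
    rewrite [leLHS](@Rintegral_itv_split _ _ _ (pi - delta))//; [|lra|lra].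
    by rewrite lerD2l; apply: Rintegral_itv_le_cst => //; lra.
  rewrite subKr subr0.
  have -> : N.+1%:R * (2 / pi) * J * delta = J / 4.
    have key (p n j : R) : p != 0 -> n != 0 -> n * (2 / p) * j * (p / (8 * n)) = j / 4.
      by move=> p_neq0 n_neq0; field; rewrite p_neq0 n_neq0.
    by apply: key; rewrite gt_eqF.
  by move=> h; lra.
have sd : sigma / N.+1%:R <= sin delta.
  rewrite ler_pdivrMr//; have := normr_sin_nat_le N.+1 delta.
  rewrite (_ : N.+1%:R * delta = pi / 8); last first.
    have key (p n : R) : n != 0 -> n * (p / (8 * n)) = p / 8 by move=> n_neq0; field.
    by apply: key; rewrite gt_eqF.
  rewrite !ger0_norm; last 2 first.
  - by apply: sin_ge0_pi; apply/andP; split; lra.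
  - by apply: sin_ge0_pi; apply/andP; split; lra.
  by rewrite (mulrC _ (sin delta)).
(* This sign makes the power of sin monotone, so a lower bound on sin bounds the weight below. *)
have b0 : 0 <= 2 * alpha + 1 by lra.
have sin_ge y : y \in `[delta, pi - delta] -> sin delta <= sin y.
  rewrite in_itv/= => /andP[y1 y2].
  (* The reflection y -> pi - y preserves sin and the interval, and sin increases up to pi / 2. *)
  wlog y3 : y y1 y2 / y <= pi / 2.
    move=> H; have [|y3] := leP y (pi / 2); first exact: H.
    have -> : sin y = sin (pi - y) by rewrite sinB sinpi cospi; ring.
    by apply: H; lra.
  have [->//|yd] := eqVneq y delta.
  rewrite ltW// ltr_sin ?in_itv/= ?lt_neqAle 1?eq_sym ?yd//.
    by apply/andP; split; lra.
  by apply/andP; split; lra.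
have sdelta0 : 0 < sin delta by rewrite (lt_le_trans _ sd)// divr_gt0.
have csin : {in `[delta, pi - delta]%classic, continuous (fun y
  : R => T y ^+ 2 * sin y `^ (2 * alpha + 1))}.
  move=> y /set_mem/= yI; apply: cvgM; first exact: cT2.
  have sy0 := lt_le_trans sdelta0 (sin_ge y yI).
  exact: continuous_comp (@continuous_sin R y) (continuous_powR sy0).
pose Iw := \int[lebesgue_measure]_(y in `[-1, 1]) (q.[y] ^+ 2 * (1 - y ^+ 2) `^ alpha).
have JmI : (sigma / N.+1%:R) `^ (2 * alpha + 1) * Jm <= Iw.
  apply: (@le_trans _ _ (\int[lebesgue_measure]_(y in `[cos (pi - delta), cos delta])
     (q.[y] ^+ 2 * (1 - y ^+ 2) `^ alpha))).
    rewrite integral_cos_substitution//; last lra.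
    rewrite -RintegralZl//; last exact: continuous_itv_integrable.
    apply: le_Rintegral => //.
    - apply: continuous_itv_integrable; apply: continuousMf => // y; exact: cvg_cst.
    - apply: continuous_compact_integrable; first exact: segment_compact.
      exact: continuous_in_subspaceT.
    - move=> y yI; rewrite mulrC ler_wpM2l ?sqr_ge0// ge0_ler_powR ?nnegrE//.
      + by rewrite divr_ge0// ltW.
      + by rewrite (le_trans _ (sin_ge y yI))// ltW.
      + exact: le_trans sd (sin_ge y yI).
  apply: ge0_subset_Rintegral => //.
  - rewrite (_ : (fun y => _) = fun y => (q ^+ 2).[y] * (1 - y ^+ 2) `^ alpha).
      apply: (integrableMr _ _ _ wi) => //; first exact: measurable_poly.
      exact: bounded_horner.
    by apply/funext => y; rewrite horner_exp.
  - by move=> y; rewrite mulr_ge0 ?sqr_ge0 ?powR_ge0.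
  - by apply: subset_itv; rewrite bnd_simp ?cos_geN1 ?cos_le1.
have [/andP[t0 tpi] <-] := acos_def x11.
rewrite (le_trans (supT (acos x)))//.
have s1 : 0 < (sigma / N.+1%:R) `^ (2 * alpha + 1) by rewrite powR_gt0// divr_gt0.
have JI : J <= 2 * ((sigma / N.+1%:R) `^ (2 * alpha + 1))^-1 * Iw.
  rewrite (le_trans JJm)// -mulrA ler_wpM2l// mulrC ler_pdivlMr//.
  by rewrite mulrC.
rewrite -[X in _ <= X]/(_ * Iw).
have -> : 4 / pi * sigma `^ (- (2 * alpha + 1)) * N.+1%:R `^ (2 * alpha + 2)
   = N.+1%:R * (2 / pi) * (2 * ((sigma / N.+1%:R) `^ (2 * alpha + 1))^-1).
  have -> : ((sigma / N.+1%:R) `^ (2 * alpha + 1))^-1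
      = sigma `^ (- (2 * alpha + 1)) * N.+1%:R `^ (2 * alpha + 1).
    rewrite powRM ?invr_ge0//; last exact: ltW.
    by rewrite invfM -powRN -(powR_inv1 (ler0n _ _)) -powRrM mulN1r -powRN opprK.
  have -> : 2 * alpha + 2 = (2 * alpha + 1) + 1 by ring.
  rewrite (@powRD _ _ _ 1) ?powRr1 ?(gt_eqF N0) ?implybT//.
  have key (u v p : R) : 4 / p * u * (v * N.+1%:R) = N.+1%:R * (2 / p) * (2 * (u * v)).
    by move: (N.+1%:R : R) (p^-1) => n ip; ring.
  by rewrite key.
by rewrite -[leRHS]mulrA ler_wpM2l// mulr_ge0// divr_ge0// ltW.
Qed.

(** * Orthonormal expansions in one variable *)

Definition weighted_mean (R : realType) (alpha : R) (p : {poly R}) : R :=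
  \int[lebesgue_measure]_(x in `[-1, 1]) (p.[x] * (1 - x ^+ 2) `^ alpha).

Section weighted_mean_theory.
Variables (R : realType) (alpha : R).
Hypothesis weight_integrable :
  lebesgue_measure.-integrable `[-1, 1] (EFin \o ultraspherical_weight alpha).
Local Notation L := (weighted_mean alpha).

Lemma integrable_horner_weight (p : {poly R}) :
  lebesgue_measure.-integrable `[-1, 1]
    (fun x => (p.[x] * (1 - x ^+ 2) `^ alpha)%:E).
Proof.
apply: (integrableMr _ _ _ weight_integrable) => //; first exact: measurable_poly.
exact: bounded_horner.
Qed.

Lemma weighted_meanD p q : L (p + q) = L p + L q.
Proof.
rewrite /weighted_mean -RintegralD//; try exact: integrable_horner_weight.
by apply: eq_Rintegral => x _; rewrite hornerD mulrDl.
Qed.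

Lemma weighted_meanZ c p : L (c *: p) = c * L p.
Proof.
rewrite /weighted_mean -RintegralZl//; last exact: integrable_horner_weight.
by apply: eq_Rintegral => x _; rewrite hornerZ mulrA.
Qed.

Lemma weighted_mean0 : L 0 = 0.
Proof. by rewrite -(scale0r 0) weighted_meanZ mul0r. Qed.

Lemma weighted_mean_sum (I : Type) (s : seq I) (P : pred I) (p : I -> {poly R}) :
  L (\sum_(i <- s | P i) p i) = \sum_(i <- s | P i) L (p i).
Proof. exact: (big_morph _ weighted_meanD weighted_mean0). Qed.

Lemma normr_weighted_mean_le (p : {poly R}) (M : R) :
  (forall x, -1 <= x <= 1 -> `|p.[x]| <= M) -> `|L p| <= M * L 1.
Proof.
move=> pM; rewrite -weighted_meanZ.
rewrite (le_trans (le_normr_Rintegral _ (integrable_horner_weight p)))//.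
apply: le_Rintegral => //.
- exact: (integrable_norm (integrable_horner_weight p)).
- exact: integrable_horner_weight.
- move=> x /=; rewrite in_itv/= => x11.
  rewrite normrM hornerZ hornerC mulr1 (@ger0_norm _ (_ `^ _)) ?powR_ge0//.
  by rewrite ler_wpM2r ?powR_ge0 ?pM.
Qed.

End weighted_mean_theory.

Section orthonormal_jacobi_theory.
Variables (R : realType) (alpha : R) (P : nat -> {poly R}).
Hypothesis orthoP : orthonormal_jacobi alpha P.
Local Notation L := (weighted_mean alpha).

Lemma orthonormal_jacobi_mean j k : L (P j * P k) = (j == k)%:R.
Proof.
case: orthoP => _ _ <-; apply: eq_Rintegral => x _.
by rewrite hornerM.
Qed.

Lemma orthonormal_jacobi0 : exists2 c, P 0 = c%:P & c != 0.
Proof.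
case: orthoP => /(_ 0%N) s0 _ _; exists (P 0)`_0.
  by apply: size1_polyC; rewrite s0.
have: lead_coef (P 0) != 0 by rewrite lead_coef_eq0 -size_poly_eq0 s0.
by rewrite lead_coefE s0.
Qed.

(** Read off from the normalization of P_0, a nonzero constant c: the integral of c^2 times the
    weight has real value 1, which excludes an infinite integral. *)
Lemma orthonormal_weight_integrable :
  lebesgue_measure.-integrable `[-1, 1] (EFin \o ultraspherical_weight alpha).
Proof.
have [c P0 c0] := orthonormal_jacobi0.
have mw : measurable_fun (`[-1, 1]%classic
  : set R) (EFin \o ultraspherical_weight alpha).
  apply/measurable_EFinP; apply: (measurableT_comp (measurable_powR alpha)).
  by apply: measurable_funB => //; exact: measurable_funX.
apply/integrableP; split => //.
have := orthonormal_jacobi_mean 0 0; rewrite eqxx /weighted_mean /Rintegral P0.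
rewrite (_ : (\int[_]_(x in _) _)%E
  = ((c * c)%:E * \int[lebesgue_measure]_(x in `[(-1)%R,
    1%R]) `|(EFin \o ultraspherical_weight alpha) x|)%E).
  case: (\int[lebesgue_measure]_(x in `[(-1)%R, 1%R]) _)%E => [r||].
  - by rewrite ltry.
  (* An infinite integral would be sent by [fine] to 0, whereas its value is 1. *)
  - rewrite gt0_muley ?lte_fin ?lt0r ?mulf_neq0 -?expr2 ?sqr_ge0//=.
    by move=> /esym/eqP; rewrite oner_eq0.
  - by rewrite ltNye.
rewrite -ge0_integralZl//; last 2 first.
- by apply: measurableT_comp.
- by rewrite lee_fin -expr2 sqr_ge0.
apply: eq_integral => x _ /=; rewrite -EFinM ger0_norm ?powR_ge0//.
by rewrite -polyCM hornerC.
Qed.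

Let wi := orthonormal_weight_integrable.

Lemma weighted_mean1_gt0 : 0 < L 1.
Proof.
have [c P0 c0] := orthonormal_jacobi0.
have := orthonormal_jacobi_mean 0 0.
rewrite eqxx P0 -polyCM -[_%:P]mulr1 mul_polyC weighted_meanZ// -expr2.
move=> h; have : 0 < c ^+ 2 * L 1 by rewrite h.
by rewrite pmulr_rgt0// lt0r sqrf_eq0 c0 sqr_ge0.
Qed.

Lemma weighted_mean_sqr_sum (N : nat) (a : nat -> R) :
  L ((\sum_(k < N) a k *: P k) ^+ 2) = \sum_(k < N) a k ^+ 2.
Proof.
rewrite expr2 mulr_suml weighted_mean_sum//; apply: eq_bigr => k _.
rewrite mulr_sumr weighted_mean_sum// (bigD1 k)//= big1 ?addr0 => [|l lk].
  by rewrite -scalerAl -scalerAr !weighted_meanZ// orthonormal_jacobi_mean eqxx mulr1.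
rewrite -scalerAl -scalerAr !weighted_meanZ// orthonormal_jacobi_mean.
by rewrite (_ : (k == l :> nat) = false) ?mulr0//; apply/negbTE; rewrite eq_sym.
Qed.

(** Since [P n] has size exactly n + 1, subtracting a multiple of it cancels the coefficient of
    degree n; induction gives some expansion, and orthonormality identifies its coefficients. *)
Lemma orthonormal_jacobi_expand (n : nat) (A : {poly R}) : (size A <= n)%N ->
  A = \sum_(k < n) L (A * P k) *: P k.
Proof.
move=> sA.
have [c cA] : exists c : nat -> R, A = \sum_(k < n) c k *: P k.
  elim: n A sA => [|n IH] A sA.
    by exists (fun=> 0); rewrite big_ord0; apply/eqP; rewrite -size_poly_leq0.
  pose u := A`_n / lead_coef (P n).
  have [sP lP _] := orthoP.
  have [|c cA] := IH (A - u *: P n).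
    apply/leq_sizeP => j; rewrite leq_eqVlt => /predU1P[<-|nj].
      rewrite coefB coefZ -[(P n)`_n](_ : lead_coef (P n) = _);
        last by rewrite lead_coefE sP.
      by rewrite divfK ?subrr// gt_eqF.
    rewrite coefB coefZ !nth_default ?mulr0 ?subr0//; first by rewrite sP.
    exact: leq_trans sA nj.
  exists (fun k => if k == n then u else c k).
  rewrite big_ord_recr/= eqxx -[LHS](subrK (u *: P n)) cA; congr (_ + _).
  by apply: eq_bigr => k _; rewrite ltn_eqF.
rewrite {1}cA; apply: eq_bigr => k _; congr (_ *: _).
rewrite cA mulr_suml weighted_mean_sum// (bigD1 k)//= big1 ?addr0 => [|l lk].
  by rewrite -scalerAl weighted_meanZ// orthonormal_jacobi_mean eqxx mulr1.
rewrite -scalerAl weighted_meanZ// orthonormal_jacobi_mean.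
by rewrite (_ : (l == k :> nat) = false) ?mulr0//; apply/negbTE.
Qed.

(** With P_0 = c, normalization says c^2 L(1) = 1, so the degree-0 component of A is the average
    L(A) / L(1), which obeys any bound on |A|, whatever alpha is. *)
Lemma orthonormal_jacobi_mean_term (A : {poly R}) (M x : R) :
  (forall x, -1 <= x <= 1 -> `|A.[x]| <= M) ->
  `|L (A * P 0) * (P 0).[x]| <= M.
Proof.
move=> AM; have [c P0 c0] := orthonormal_jacobi0.
rewrite P0 hornerC mulrC [A * _]mulrC mul_polyC weighted_meanZ// mulrA -expr2 normrM.
have c2 : c ^+ 2 * L 1 = 1.
  have := orthonormal_jacobi_mean 0 0.
  by rewrite eqxx P0 -polyCM -[_%:P]mulr1 mul_polyC weighted_meanZ.
rewrite -[leRHS]mulr1 -c2 mulrCA ger0_norm ?sqr_ge0// ler_wpM2l ?sqr_ge0//.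
exact: normr_weighted_mean_le.
Qed.

End orthonormal_jacobi_theory.

(** [nikolskii] is applied to the reproducing kernel q = sum_k P_k(x) P_k. Both q(x) and the
    weighted integral of q^2 equal S = sum_k P_k(x)^2, so the inequality reads S^2 <= C (N + 1)^(2
    alpha + 2) S. *)
Lemma christoffel_bound (R : realType) (alpha : R) : - 2^-1 <= alpha ->
  exists2 C : R, 0 < C & forall P : nat -> {poly R}, orthonormal_jacobi alpha P ->
    forall (N : nat) (x : R), -1 <= x <= 1 ->
    \sum_(k < N.+1) (P k).[x] ^+ 2 <= C * N.+1%:R `^ (2 * alpha + 2).
Proof.
move=> ha; have [C C0 nik] := nikolskii ha.
exists C => // P oP N x x11.
pose q := \sum_(k < N.+1) (P k).[x] *: P k.
have sq : (size q <= N.+1)%N.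
  apply: (leq_trans (size_sum _ _ _)); apply/bigmax_leqP => k _.
  by rewrite (leq_trans (size_scale_leq _ _))//; case: oP => -> _ _; exact: ltn_ord.
have := nik N q x sq x11 (orthonormal_weight_integrable oP).
set S := \sum_(k < N.+1) _.
have -> : q.[x] = S.
  by rewrite horner_sum; apply: eq_bigr => k _; rewrite hornerZ expr2.
rewrite (_ : \int[_]_(y in _) _ = S); last first.
  rewrite -[RHS](weighted_mean_sqr_sum oP N.+1 (fun k => (P k).[x]));
    apply: eq_Rintegral => y _.
  by rewrite horner_exp.
have [->|Sn0] := eqVneq S 0; first by rewrite mulr_ge0 ?powR_ge0// ltW.
have S0 : 0 < S by rewrite lt0r Sn0 sumr_ge0// => k _; exact: sqr_ge0.
by rewrite expr2 ler_pM2r.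
Qed.

(** * Taylor approximation of the exponentials *)

(* For i >= n, Y^i <= e^(-2n) (e^2 Y)^i. *)
Lemma exp_tail_le (R : realType) (Y : R) (n k : nat) : 0 <= Y -> expR 2 * Y <= n%:R ->
  \sum_(n <= i < k) Y ^+ i / i`!%:R <= expR (- n%:R).
Proof.
move=> Y0 Yn; pose l : R := expR 2.
have l0 : 0 < l by exact: expR_gt0.
have l1 : 1 <= l by rewrite ltW// expR_gt1.
apply: (@le_trans _ _ (\sum_(n <= i < k) l ^- n * ((l * Y) ^+ i / i`!%:R))).
  rewrite big_seq [leRHS]big_seq; apply: ler_sum => i.
  rewrite mem_index_iota => /andP[ni _].
  rewrite mulrA ler_wpM2r ?invr_ge0// exprMn mulrA ler_peMl ?exprn_ge0//.
  by rewrite ler_pdivlMl ?exprn_gt0// mulr1 ler_weXn2l.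
rewrite -mulr_sumr.
have expk : \sum_(n <= i < k) ((l * Y) ^+ i / i`!%:R) <= expR (l * Y).
  have lY0 : 0 <= l * Y by rewrite mulr_ge0// ltW.
  apply: (@le_trans _ _ (series (exp_coeff (l * Y)) k)).
    rewrite /series/=; have [nk|kn] := leqP n k; last first.
      rewrite big_geq ?(ltnW kn)// sumr_ge0// => i _.
      by rewrite /exp_coeff/= divr_ge0// exprn_ge0.
    rewrite [leRHS](@big_cat_nat _ _ _ n)//= lerDr sumr_ge0// => i _.
    by rewrite /exp_coeff/= divr_ge0// exprn_ge0.
  apply: nondecreasing_cvgn_le; last exact: is_cvg_series_exp_coeff.
  apply/nondecreasing_seqP => i; rewrite -subr_ge0 -[_ - _]/(series _ _ - series _ _).
  by rewrite seriesSB /exp_coeff/= divr_ge0// exprn_ge0.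
apply: (@le_trans _ _ (l ^- n * expR n%:R)).
  apply: ler_wpM2l; first by rewrite invr_ge0 exprn_ge0// ltW.
  by rewrite (le_trans expk)// ler_expR.
rewrite /l -expRM_natr -expRN -expRD ler_expR; lra.
Qed.

Lemma normr_lim_series_tail_le (R : realType) (u : R^nat) (l e : R) (n : nat) :
  series u @ \oo --> l -> (forall k, \sum_(n <= i < k) `|u i| <= e) ->
  `|l - series u n| <= e.
Proof.
move=> ul ue.
have : (fun k => `|series u k - series u n|) @ \oo --> `|l - series u n|.
  by apply: cvg_norm; apply: cvgB => //; exact: cvg_cst.
move=> /cvgr_to_le; apply; near=> k.
have nk : (n <= k)%N by near: k; exact: nbhs_infty_ge.
rewrite sub_series_geq// (le_trans _ (ue k))//; exact: ler_norm_sum.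
Unshelve. all: by end_near. Qed.

(** The terms of the cosine and sine series are dominated by those of the exponential series, so
    [exp_tail_le] covers both remainders. What matters is that the degree is only linear in |c|. *)
Lemma trigo_taylor (R : realType) (c : R) (n : nat) : expR 2 * `|c| <= n%:R ->
  exists A B : {poly R}, [/\ (size A <= n)%N, (size B <= n)%N,
    (forall x, -1 <= x <= 1 -> `|cos (c * x) - A.[x]| <= expR (- n%:R)) &
    (forall x, -1 <= x <= 1 -> `|sin (c * x) - B.[x]| <= expR (- n%:R))].
Proof.
move=> cn.
have bnd x (u : R^nat) : -1 <= x <= 1 ->
    (forall k, `|u k| <= `|c * x| ^+ k / k`!%:R) ->
    forall k, \sum_(n <= i < k) `|u i| <= expR (- n%:R).
  move=> x11 uk k; apply: le_trans (exp_tail_le k (normr_ge0 c) cn).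
  apply: ler_sum => i _; rewrite (le_trans (uk i))// ler_wpM2r ?invr_ge0//.
  rewrite lerXn2r ?nnegrE// normrM ler_piMr// ler_norml.
  by move: x11.
exists (\poly_(k < n) cos_coeff c k), (\poly_(k < n) sin_coeff c k).
split; try exact: size_poly.
- move=> x x11.
  have -> : (\poly_(k < n) cos_coeff c k).[x] = series (cos_coeff (c * x)) n.
    rewrite horner_poly /series/= big_mkord; apply: eq_bigr => k _.
    by rewrite /cos_coeff/= exprMn mulrAC !mulrA.
  apply: normr_lim_series_tail_le.
    rewrite unlock; exact: is_cvg_series_cos_coeff.
  apply: (bnd x) => // k; rewrite /cos_coeff/= !normrM normfV !normr_nat !normrX normrM.
  rewrite ler_wpM2r ?invr_ge0// normrN1 expr1n mulr1.
  by case: odd; rewrite /= ?mul0r ?mul1r// exprn_ge0// mulr_ge0.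
- move=> x x11.
  have -> : (\poly_(k < n) sin_coeff c k).[x] = series (sin_coeff (c * x)) n.
    rewrite horner_poly /series/= big_mkord; apply: eq_bigr => k _.
    by rewrite /sin_coeff/= exprMn mulrAC !mulrA.
  apply: normr_lim_series_tail_le.
    rewrite unlock; exact: is_cvg_series_sin_coeff.
  apply: (bnd x) => // k; rewrite /sin_coeff/= !normrM normfV !normr_nat !normrX normrM.
  rewrite ler_wpM2r ?invr_ge0// normrN1 expr1n mulr1.
  by case: odd; rewrite /= ?mul0r ?mul1r// exprn_ge0// mulr_ge0.
Qed.

(** * Estimates for the complex modulus *)

Section normc_theory.
Variable R : realType.
Implicit Types z w : R[i].

Lemma normc_normE z : (normc z)%:C = `|z|.
Proof. by rewrite normc_def; case: z. Qed.

Lemma normc_ge0 z : 0 <= normc z.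
Proof. by case: z => a b; exact: sqrtr_ge0. Qed.

Lemma normcD z w : normc (z + w) <= normc z + normc w.
Proof. by rewrite -lecR rmorphD/= !normc_normE ler_normD. Qed.

Lemma normcN z : normc (- z) = normc z.
Proof. by case: z => a b /=; rewrite !sqrrN. Qed.

Lemma normcB z w : normc (z - w) <= normc z + normc w.
Proof. by rewrite (le_trans (normcD _ _))// normcN. Qed.

Lemma normc_sum (I : Type) (s : seq I) (p : pred I) (F : I -> R[i]) :
  normc (\sum_(i <- s | p i) F i) <= \sum_(i <- s | p i) normc (F i).
Proof.
elim/big_rec2: _ => [|i x y _ IH]; first by rewrite normc0.
by rewrite (le_trans (normcD _ _))// lerD2l.
Qed.

Lemma normc_prod (I : Type) (s : seq I) (p : pred I) (F : I -> R[i]) :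
  normc (\prod_(i <- s | p i) F i) = \prod_(i <- s | p i) normc (F i).
Proof.
by elim/big_rec2: _ => [|i x y _ IH]; rewrite ?normc1// normcM IH.
Qed.

Lemma normc_le_ReIm z : normc z <= `|complex.Re z| + `|complex.Im z|.
Proof.
case: z => a b /=; rewrite -[leRHS]ger0_norm ?addr_ge0// -sqrtr_sqr ler_wsqrtr//.
rewrite sqrrD !real_normK ?num_real// -subr_ge0.
rewrite (_ : _ - _ = `|a| * `|b| *+ 2); first by rewrite mulrn_wge0// mulr_ge0.
by ring.
Qed.

Lemma normr_Re_le z : `|complex.Re z| <= normc z.
Proof.
by case: z => a b /=; rewrite -sqrtr_sqr ler_wsqrtr// lerDl sqr_ge0.
Qed.

Lemma normr_Im_le z : `|complex.Im z| <= normc z.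
Proof.
by case: z => a b /=; rewrite -sqrtr_sqr ler_wsqrtr// lerDr sqr_ge0.
Qed.

Lemma sqr_normc z : normc z ^+ 2 = complex.Re z ^+ 2 + complex.Im z ^+ 2.
Proof. by case: z => a b /=; rewrite sqr_sqrtr// addr_ge0 ?sqr_ge0. Qed.

Lemma Re_sum (I : Type) (s : seq I) (p : pred I) (F : I -> R[i]) :
  complex.Re (\sum_(i <- s | p i) F i) = \sum_(i <- s | p i) complex.Re (F i).
Proof. by elim/big_rec2: _ => // i x y _ <-; case: (F i) y => ? ? []. Qed.

Lemma Im_sum (I : Type) (s : seq I) (p : pred I) (F : I -> R[i]) :
  complex.Im (\sum_(i <- s | p i) F i) = \sum_(i <- s | p i) complex.Im (F i).
Proof. by elim/big_rec2: _ => // i x y _ <-; case: (F i) y => ? ? []. Qed.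

Lemma ReMreal z (x : R) : complex.Re (z * x%:C) = complex.Re z * x.
Proof. by case: z => a b /=; rewrite mulr0 subr0. Qed.

Lemma ImMreal z (x : R) : complex.Im (z * x%:C) = complex.Im z * x.
Proof. by case: z => a b /=; rewrite mulr0 add0r. Qed.

Lemma ReB z w : complex.Re (z - w) = complex.Re z - complex.Re w.
Proof. by case: z w => ? ? []. Qed.

Lemma ImB z w : complex.Im (z - w) = complex.Im z - complex.Im w.
Proof. by case: z w => ? ? []. Qed.

(** Telescoping: the factors are exchanged one at a time, each exchange costing e times a product of
    factors bounded by K. *)
Lemma normc_prodB (I : Type) (s : seq I) (F G : I -> R[i]) (K e : R) :
  1 <= K -> 0 <= e ->
  (forall i, normc (F i) <= K) -> (forall i, normc (G i) <= K) ->
  (forall i, normc (F i - G i) <= e) ->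
  normc (\prod_(i <- s) F i - \prod_(i <- s) G i) <= (size s)%:R * K ^+ size s * e.
Proof.
move=> K1 e0 FK GK FGe; have K0 : 0 <= K by rewrite (le_trans _ K1).
elim: s => [|i s IH]; first by rewrite !big_nil subrr normc0 !mul0r.
rewrite !big_cons.
rewrite (_ : _ - _ = F i * (\prod_(j <- s) F j - \prod_(j <- s) G j)
  + (F i - G i) * \prod_(j <- s) G j); last by ring.
have Gs : normc (\prod_(j <- s) G j) <= K ^+ size s.
  elim: s {IH} => [|j l IHl]; first by rewrite big_nil normc1.
  by rewrite big_cons normcM exprS ler_pM ?normc_ge0.
rewrite (le_trans (normcD _ _))// !normcM.
rewrite (_ : _ * e = K * ((size s)%:R * K ^+ size s * e) + e * K ^+ (size s).+1);
  last first.
  by rewrite /= exprS -natr1; ring.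
apply: lerD; first by rewrite ler_pM ?normc_ge0.
by rewrite ler_pM ?normc_ge0// (le_trans Gs)// exprS ler_peMl// exprn_ge0.
Qed.

End normc_theory.

(** * Decay of the Fourier coefficients *)

(** A discrete integral test. Divided by (k + 1)^(1 - u) it reads 1 + 1 / (k + 1) <= ((k + 1) /
    k)^(u - 1), and u >= 2 makes the right side at least (k + 1) / k = 1 + 1 / k. *)
Lemma powR_telescope (R : realType) (u : R) (k : nat) : 2 <= u -> (0 < k)%N ->
  k.+1%:R `^ (- u) <= k%:R `^ (1 - u) - k.+1%:R `^ (1 - u) :> R.
Proof.
move=> u2 k0; set x : R := k%:R; set y : R := k.+1%:R.
have x0 : 0 < x by rewrite ltr0n.
have y0 : 0 < y by rewrite ltr0n.
have yx : y = x + 1 by rewrite /y -natr1.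
have E v : y `^ v = y `^ (1 + v) / y.
  by rewrite powRD ?(gt_eqF y0) ?implybT// powRr1 ?ltW// mulrAC mulfV ?mul1r// gt_eqF.
have xE : x `^ (1 - u) = y `^ (1 - u) * (y / x) `^ (u - 1).
  rewrite powRM ?invr_ge0 ?ltW// -(powR_inv1 (ltW x0)) -powRrM mulN1r opprB.
  rewrite mulrA -powRD; last by rewrite (gt_eqF y0) implybT.
  by rewrite (_ : 1 - u + (u - 1) = 0) ?powRr0 ?mul1r//; ring.
have yx1 : 1 <= y / x by rewrite ler_pdivlMr// mul1r yx lerDl.
have h1 : y / x <= (y / x) `^ (u - 1) by apply: le1r_powR => //; lra.
have h2 : 1 + y^-1 <= y / x.
  rewrite (_ : y / x = 1 + x^-1); last by rewrite yx mulrDl mulfV ?gt_eqF// mul1r.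
  by rewrite lerD2l lef_pV2 ?posrE// yx lerDl.
by rewrite E xE -[X in _ <= _ - X]mulr1 -mulrBr ler_wpM2l ?powR_ge0// lerBrDl
  (le_trans h2).
Qed.

Lemma powR_tail_sum_le (R : realType) (u : R) (M L : nat) : 2 <= u ->
  \sum_(M.+1 <= k < L) k.+1%:R `^ (- u) <= M.+1%:R `^ (1 - u) :> R.
Proof.
move=> u2; have [LM|ML] := leqP L M.+1; first by rewrite big_geq ?powR_ge0.
apply: (@le_trans _ _ (\sum_(M.+1 <= k < L) (- k.+1%:R `^ (1 - u) - (- k%:R `^ (1 -
  u))))).
  rewrite big_seq [leRHS]big_seq; apply: ler_sum => k.
  rewrite mem_index_iota => /andP[Mk _].
  by rewrite opprK addrC powR_telescope//; exact: leq_trans Mk.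
have -> := @telescope_sumr _ M.+1 L (fun k => - k%:R `^ (1 - u) : R) (ltnW ML).
by rewrite opprK gerDr oppr_le0 powR_ge0.
Qed.

Lemma ler_sum_uniq_sub (R : numDomainType) (T : eqType) (s1 s2 : seq T) (F : T -> R) :
  uniq s1 -> uniq s2 -> {subset s1 <= s2} -> (forall x, 0 <= F x) ->
  \sum_(x <- s1) F x <= \sum_(x <- s2) F x.
Proof.
move=> u1 u2 s12 F0; rewrite [leRHS](bigID (mem s1))/=.
have pm : perm_eq [seq x <- s2 | x \in s1] s1.
  apply: uniq_perm; rewrite ?filter_uniq// => x.
  by rewrite mem_filter/=; case: (boolP (x \in s1)) => //= /s12.
by rewrite -[X in _ <= X + _]big_filter (perm_big _ pm)/= lerDl sumr_ge0.
Qed.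

(** Each natural number is the absolute value of at most two integers. *)
Lemma int_sum_le (R : realType) (s : seq int) (g : nat -> R) (G : R) : uniq s ->
  (forall k, 0 <= g k) -> (forall L, \sum_(k < L) g k <= G) ->
  \sum_(q <- s) g `|q|%N <= 2 * G.
Proof.
move=> us g0 gG; pose L := \max_(q <- s) `|q|%N.
pose s2 := map Posz (iota 0 L.+1) ++ map (fun k => - Posz k) (iota 1 L).
have qL q : q \in s -> (`|q| <= L)%N.
  by move=> qs; rewrite /L (big_rem q)//= leq_maxl.
have us2 : uniq s2.
  rewrite cat_uniq !map_inj_uniq ?iota_uniq//=; last 2 first.
  - by move=> i j /oppr_inj [].
  - by move=> i j [].
  rewrite andbT; apply/hasPn => q /mapP[k]; rewrite mem_iota => /andP[k1 _] ->.
  apply/negP => H; have /mapP[j _ e]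
    : - Posz k \in [seq Posz i | i <- iota 0 L.+1] := H.
  by move: e; lia.
apply: (@le_trans _ _ (\sum_(q <- s2) g `|q|%N)).
  apply: ler_sum_uniq_sub => // q qs; rewrite mem_cat; apply/orP.
  have := qL _ qs; case: q {qs} => k kL.
    by left; apply/mapP; exists k; rewrite // mem_iota; lia.
  by right; apply/mapP; exists k.+1; [rewrite mem_iota; lia|rewrite NegzE].
rewrite big_cat !big_map mulr2n mulrDl mul1r; apply: lerD.
  have -> : iota 0 L.+1 = index_iota 0 L.+1 by rewrite /index_iota subn0.
  by rewrite big_mkord.
rewrite (le_trans _ (gG L.+1))// -(big_mkord xpredT g) big_ltn// /index_iota subn1.
by under eq_bigr do rewrite abszN; rewrite lerDr.
Qed.

(** The 4 is twice 1 + 1: the term k = 0 is 1, and the remaining ones telescope to at most 1. *)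
Lemma int_powR_sum_le (R : realType) (u : R) (s : seq int) : 2 <= u -> uniq s ->
  \sum_(q <- s) (`|q|%N.+1)%:R `^ (- u) <= 4 :> R.
Proof.
move=> u2 us.
have := @int_sum_le R s (fun k => k.+1%:R `^ (- u)) 2 us.
rewrite (_ : 2 * 2 = 4); last by ring.
apply; first by move=> k; exact: powR_ge0.
case=> [|L]; first by rewrite big_ord0.
rewrite -(big_mkord xpredT (fun k => k.+1%:R `^ (- u))) big_ltn// powR1.
rewrite (_ : 2 = 1 + 1 :> R) ?lerD2l; last by ring.
by rewrite (le_trans (powR_tail_sum_le 0 L.+1 u2))// powR1.
Qed.

Lemma int_powR_tail_sum_le (R : realType) (u : R) (M : nat) (s : seq int) : 2 <= u
  -> uniq s ->
  \sum_(q <- s) (if (M < `|q|)%N then (`|q|%N.+1)%:R `^ (- u) else 0)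
    <= 2 * M.+1%:R `^ (1 - u) :> R.
Proof.
move=> u2 us.
have := @int_sum_le R s (fun k => if (M < k)%N then k.+1%:R `^ (- u) else 0) (M.+1%:R
  `^ (1 - u)) us.
apply; first by move=> k; case: ifP => // _; exact: powR_ge0.
move=> L; rewrite -(big_mkord xpredT (fun k => if (M < k)%N then k.+1%:R `^ (- u)
  else 0)).
have [LM|ML] := leqP L M.+1.
  rewrite big_seq big1 ?powR_ge0// => k; rewrite mem_index_iota => /andP[_ kL].
  by rewrite ifF//; apply/negbTE; rewrite -leqNgt -ltnS (leq_trans kL).
rewrite (@big_cat_nat _ _ _ M.+1)//=; last exact: ltnW.
rewrite big_seq big1 ?add0r => [|k]; last first.
  rewrite mem_index_iota => /andP[_ kL].
  by rewrite ifF//; apply/negbTE; rewrite -leqNgt -ltnS.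
apply: le_trans (powR_tail_sum_le M L u2).
rewrite big_seq [leRHS]big_seq; apply: ler_sum => k.
by rewrite mem_index_iota => /andP[-> _].
Qed.

(** With s the finite set of all entries occurring in B, the list B embeds in the grid s^d, over
    which the sum of products is a product of sums. *)
Lemma tuple_prod_sum_le (R : realType) (d : nat) (T : choiceType) (B : seq (d.-tuple T))
    (g : 'I_d -> T -> R) (G : 'I_d -> R) :
  uniq B -> (forall j x, 0 <= g j x) ->
  (forall j s, uniq s -> \sum_(x <- s) g j x <= G j) ->
  \sum_(p <- B) \prod_(j < d) g j (tnth p j) <= \prod_(j < d) G j.
Proof.
move=> uB g0 gG.
pose s := undup (flatten (map val B)).
have sB (p : d.-tuple T) j : p \in B -> tnth p j \in s.
  move=> pB; rewrite mem_undup; apply/flattenP; exists (val p).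
    by apply/mapP; exists p.
  exact: mem_tnth.
pose phi (f : {ffun 'I_d -> seq_sub s}) : d.-tuple T := [tuple ssval (f j) | j < d].
have phi_inj : injective phi.
  move=> f h fh; apply/ffunP => j; apply/val_inj.
  by have := congr1 (fun t => tnth t j) fh; rewrite !tnth_mktuple.
apply: (@le_trans _ _ (\sum_(p <- map phi (enum {ffun 'I_d
  -> seq_sub s})) \prod_(j < d) g j (tnth p j))).
  apply: ler_sum_uniq_sub => //.
  - by rewrite map_inj_uniq// enum_uniq.
  - move=> p pB; apply/mapP; exists [ffun j => SeqSub (sB p j pB)];
    first by rewrite mem_enum.
    by apply: eq_from_tnth => j; rewrite tnth_mktuple ffunE.
  - by move=> p; apply: prodr_ge0.
rewrite big_map big_enum/=.
under eq_bigr => f _ do under eq_bigr => j _ do rewrite tnth_mktuple.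
rewrite -(bigA_distr_bigA (fun j (x : seq_sub s) => g j (ssval x))).
apply: ler_prod => j _; rewrite sumr_ge0//=.
rewrite (le_trans _ (gG j s (undup_uniq _)))//.
rewrite -big_enum -(big_map (@ssval _ s) xpredT (g j)) (perm_big s)//.
have val_inj' : injective (@ssval T s) by move=> y z yz; exact: val_inj.
apply: uniq_perm; rewrite ?undup_uniq//; first by rewrite map_inj_uniq// enum_uniq.
move=> x; apply/mapP/idP => [[y _ ->]|xs]; first exact: ssvalP.
by exists (SeqSub xs); rewrite ?mem_enum.
Qed.

Lemma tuple_powR_sum_le (R : realType) (d : nat) (u : R) (B : seq (d.-tuple int)) :
  2 <= u -> uniq B ->
  \sum_(p <- B) \prod_(j < d) (`|tnth p j|%N.+1)%:R `^ (- u) <= 4 ^+ d :> R.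
Proof.
move=> u2 uB; rewrite -[d in leRHS]card_ord -prodr_const.
apply: (@tuple_prod_sum_le _ _ _ _ (fun _ q => (`|q|%N.+1)%:R `^ (- u))) => // _ s.
exact: int_powR_sum_le.
Qed.

(** Union bound over the coordinate j0 that exceeds M: [g j0] discards small entries in that
    coordinate only. The resulting 2 * 4^(d - 1) is rounded up to 4^d. *)
Lemma tuple_powR_tail_sum_le (R : realType) (d : nat) (u : R) (M : nat)
    (B : seq (d.-tuple int)) : 2 <= u -> uniq B ->
  (forall p, p \in B -> exists j, (M < `|tnth p j|)%N) ->
  \sum_(p <- B) \prod_(j < d) (`|tnth p j|%N.+1)%:R `^ (- u)
    <= d%:R * (4 ^+ d * M.+1%:R `^ (1 - u)) :> R.
Proof.
move=> u2 uB BM.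
pose g (j0 j : 'I_d) (q : int) : R :=
  if (j == j0) && ~~ (M < `|q|)%N then 0 else (`|q|%N.+1)%:R `^ (- u).
have g0 j0 j q : 0 <= g j0 j q by rewrite /g; case: ifP => // _; exact: powR_ge0.
apply: (@le_trans _ _ (\sum_(j0 < d) \sum_(p <- B) \prod_(j < d) g j0 j (tnth p j))).
  rewrite exchange_big/= big_seq [leRHS]big_seq; apply: ler_sum => p /BM[j0 Mj0].
  rewrite [leRHS](bigD1 j0)//= (_ : \prod_(j < d) _ = \prod_(j < d) g j0 j (tnth p
    j)); last first.
    by apply: eq_bigr => j _; rewrite /g; case: eqP => // ->; rewrite Mj0.
  by rewrite lerDl sumr_ge0// => j _; apply: prodr_ge0.
rewrite -[d in X in _ <= X * _]card_ord mulr_natl -sumr_const; apply: ler_sum => j0 _.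
apply: (@le_trans _ _ (\prod_(j < d) (if j == j0 then 2 * M.+1%:R `^ (1 - u) else 4))).
  apply: tuple_prod_sum_le => // j s us; rewrite /g; case: eqP => /= _.
    rewrite (le_trans _ (int_powR_tail_sum_le M u2 us))//.
    by apply: ler_sum => q _; case: ltnP.
  exact: int_powR_sum_le.
rewrite (bigD1 j0)//= eqxx (eq_bigr (fun=> 4)) => [|j /negbTE -> //].
rewrite prodr_const mulrAC ler_wpM2r ?powR_ge0//.
rewrite (_ : 4 ^+ d = 4 * 4 ^+ d.-1);
  last by rewrite -exprS prednK// (leq_ltn_trans _ (ltn_ord j0)).
by apply: ler_pM; rewrite ?exprn_ge0 ?ler_nat ?cardC1 ?card_ord.
Qed.

(** * From the norms to finite sums of Fourier coefficients *)

Lemma esum_ge_sum (R : realType) (T : choiceType) (b : T -> R) (B : seq T) : uniq B ->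
  ((\sum_(p <- B) b p)%:E <= \esum_(p in [set: T]) (b p)%:E)%E.
Proof.
move=> uB; apply: esum_ge; exists [set` B].
  by split => //; exact: finite_seq.
by rewrite -fsbig_seq// sumEFin.
Qed.

Lemma esum_le_sum (R : realType) (T : choiceType) (b : T -> R) (M : R) :
  (forall B : seq T, uniq B -> \sum_(p <- B) b p <= M) ->
  (\esum_(p in [set: T]) (b p)%:E <= M%:E)%E.
Proof.
move=> bM; apply: ge_ereal_sup => /= _ [X [finX _] <-].
by rewrite fsbig_finite//= sumEFin lee_fin bM// fset_uniq.
Qed.

Lemma mixed_weightE (R : realType) (d : nat) (t : R) (p : d.-tuple int) :
  mixed_weight t p = \prod_(j < d) (`|tnth p j|%N.+1)%:R `^ t.
Proof.
apply: eq_bigr => j _; congr (_ `^ _).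
by rewrite -natr1 addrC natr_absz intr_norm.
Qed.

Lemma mixed_weight_gt0 (R : realType) (d : nat) (t : R) (p : d.-tuple int) :
  0 < mixed_weight t p.
Proof. by rewrite mixed_weightE prodr_gt0// => j _; rewrite powR_gt0. Qed.

Lemma mixed_weight_ge1 (R : realType) (d : nat) (t : R) (p : d.-tuple int) : 0 <= t ->
  1 <= mixed_weight t p.
Proof.
move=> t0; rewrite mixed_weightE; elim/big_rec: _ => // j x _ x1.
have w1 : 1 <= (`|tnth p j|%N.+1)%:R `^ t :> R.
  have n1 : 1 <= (`|tnth p j|%N.+1)%:R :> R by rewrite ler1n.
  by have := ler_powR n1 t0; rewrite powRr0.
exact: mulr_ege1.
Qed.

Lemma mixed_weightVX (R : realType) (d : nat) (t : R) (p : d.-tuple int) :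
  (mixed_weight t p)^-1 ^+ 2 = \prod_(j < d) (`|tnth p j|%N.+1)%:R `^ (- (2 * t)).
Proof.
rewrite mixed_weightE -prodfV -prodrXl; apply: eq_bigr => j _.
by rewrite -powRN -powR_mulrn ?powR_ge0// -powRrM; congr (_ `^ _); ring.
Qed.

(** Cauchy-Schwarz after writing each b p as (1 / w) (w b p), with w the mixed weight. *)
Lemma sum_le_weighted (R : realType) (d : nat) (t : R) (b : d.-tuple int -> R)
    (h G : R) (B : seq (d.-tuple int)) : 0 <= h -> 0 <= G ->
  \sum_(p <- B) (mixed_weight t p ^+ 2 * b p ^+ 2) <= h ^+ 2 ->
  \sum_(p <- B) \prod_(j < d) (`|tnth p j|%N.+1)%:R `^ (- (2 * t)) <= G ^+ 2 ->
  \sum_(p <- B) b p <= G * h.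
Proof.
move=> h0 G0 bh wG.
have [//|s0] := leP (\sum_(p <- B) b p) 0; first by move=> /le_trans; apply;
  rewrite mulr_ge0.
rewrite -(@ler_pXn2r _ 2) ?nnegrE ?mulr_ge0 ?(ltW s0)//.
have := Cauchy_Schwarz_sum B xpredT (fun p => (mixed_weight t p)^-1) (fun p =>
  mixed_weight t p * b p).
under eq_bigr do rewrite mulKf ?gt_eqF ?mixed_weight_gt0//.
move=> /le_trans; apply; rewrite exprMn ler_pM// ?sumr_ge0//.
- by move=> p _; exact: sqr_ge0.
- by move=> p _; exact: sqr_ge0.
- by under eq_bigr do rewrite mixed_weightVX.
- by under eq_bigr do rewrite exprMn.
Qed.

(** Passes from the extended-real norm to a real h; the estimates below see h only through bounds on
    finite sums. *)
Lemma H_norm_finite (R : realType) (d : nat) (t : R) (f : euclid R d -> R[i]) :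
  (H_norm t f < +oo)%E -> exists2 h : R, 0 <= h &
    H_norm t f = h%:E /\ forall B : seq (d.-tuple int), uniq B ->
    \sum_(p <- B) (mixed_weight t p ^+ 2 * normc (fourier_coef f p) ^+ 2) <= h ^+ 2.
Proof.
have h2 : (2^-1 : R) != 0 by rewrite invr_eq0 pnatr_eq0.
rewrite /H_norm => /(lty_poweRy h2).
have := @esum_ge_sum R _ (fun p => mixed_weight t p ^+ 2
  * normc (fourier_coef f p) ^+ 2).
have : (0 <= \esum_(p in [set: d.-tuple int]) (mixed_weight t p ^+ 2
  * normc (fourier_coef f p) ^+ 2)%:E)%E.
  by apply: esum_ge0 => p _; rewrite lee_fin mulr_ge0 ?sqr_ge0.
case: (\esum_(p in _) _)%E => [r||] //; rewrite lee_fin => r0 rB _.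
exists (r `^ 2^-1); first exact: powR_ge0.
split; first by rewrite poweR_EFin.
move=> B uB; rewrite -powR_mulrn ?powR_ge0// -powRrM mulVf ?powRr1//.
by have := rB _ uB; rewrite lee_fin.
Qed.

Lemma fourier_coef_summable (R : realType) (d : nat) (t : R) (f : euclid R d
  -> R[i]) (h : R) :
  1 <= t -> 0 <= h ->
  (forall B : seq (d.-tuple int), uniq B ->
    \sum_(p <- B) (mixed_weight t p ^+ 2 * normc (fourier_coef f p) ^+ 2) <= h ^+ 2) ->
  (forall B : seq (d.-tuple int), uniq B ->
    \sum_(p <- B) normc (fourier_coef f p) <= 2 ^+ d * h) /\
  (forall (M : nat) (B : seq (d.-tuple int)), uniq B ->
    (forall p, p \in B -> exists j, (M < `|tnth p j|)%N) ->
    \sum_(p <- B) normc (fourier_coef f p) <= d%:R * 2 ^+ d * M.+1%:R `^ (2^-1 - t)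
      * h).
Proof.
move=> t1 h0 fh; have u2 : 2 <= 2 * t by lra.
split=> [B uB|M B uB BM].
  apply: sum_le_weighted => //; first exact: fh.
  rewrite -exprM mulnC exprM (_ : 2 ^+ 2 = 4); last by ring.
  exact: tuple_powR_sum_le.
apply: sum_le_weighted => //; first exact: fh.
apply: (le_trans (tuple_powR_tail_sum_le u2 uB BM)).
(* The squared tail bound carries a factor d, whose square root is majorized by d. *)
have d2 : d%:R <= d%:R ^+ 2 :> R.
  by rewrite -natrX ler_nat; case: d {fh B uB BM f} => // d; rewrite leq_pmulr.
have p4 : (2 ^+ d) ^+ 2 = 4 ^+ d :> R.
  by rewrite -exprM mulnC exprM; congr (_ ^+ _); ring.
have pw : (M.+1%:R `^ (2^-1 - t)) ^+ 2 = M.+1%:R `^ (1 - 2 * t) :> R.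
  by rewrite -powR_mulrn ?powR_ge0// -powRrM; congr (_ `^ _); field.
rewrite !exprMn p4 pw -mulrA ler_wpM2r// mulr_ge0 ?exprn_ge0 ?powR_ge0//.
Qed.

(** * The Jacobi projection *)

Section tensor_jacobi.
Variables (R : realType) (d N : nat) (P : nat -> {poly R}).
Local Notation multidegree := {ffun 'I_d -> 'I_N.+1}.
Implicit Types (k l : multidegree) (x : euclid R d).

(* Unlike the products in jacobi_span, this one includes the constant factors
   P_0 of the inactive coordinates, which makes the family orthonormal. *)
Definition tensor_jacobi k x : R := \prod_(j < d) (P (k j)).[tnth x j].

(** The only set u that [admissible] allows together with k. *)
Definition active k : {set 'I_d} := [set j | (0 < k j)%N].

Definition low_order (m : nat) k : bool :=
  (#|active k| <= m)%N && (\sum_(j < d) k j <= N)%N.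

Lemma cube_bounded_tensor_jacobi k : cube_bounded (tensor_jacobi k).
Proof. by apply: cube_bounded_prod => j; exact: cube_bounded_horner. Qed.

Lemma tensor_jacobi_orthonormal alpha k l : orthonormal_jacobi alpha P ->
  weighted_integral alpha (fun x => tensor_jacobi k x
    * tensor_jacobi l x) = (k == l)%:R.
Proof.
move=> oP; rewrite (_ : (fun x => _) = fun x
  : euclid R d => \prod_(j < d) (P (k j) * P (l j)).[tnth x j]); last first.
  by apply/funext => x; rewrite -big_split; apply: eq_bigr => j _; rewrite hornerM.
rewrite weighted_integral_prod; last exact: orthonormal_weight_integrable oP.
rewrite (eq_bigr (fun j => (k j == l j)%:R)) => [|j _]; last first.
  exact: (orthonormal_jacobi_mean oP).
have [->|kl] := eqVneq k l; first by rewrite big1// => j _; rewrite eqxx.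
have [j kj] : exists j, k j != l j.
  by apply/existsP; apply: contraR kl => /existsPn H; apply/eqP/ffunP => j;
    apply/eqP/negPn/H.
by rewrite (bigD1 j)//= (negbTE kj) mul0r.
Qed.

Lemma admissible_activeE (m : nat) (uk : {set 'I_d} * multidegree) :
  admissible m uk = (uk.1 == active uk.2) && low_order m uk.2.
Proof.
case: uk => u k; rewrite /admissible /low_order /=.
have -> : [forall j, (j \in u) == (0 < k j)%N] = (u == active k).
  apply/forallP/eqP => [H|-> j]; last by rewrite inE.
  by apply/setP => j; rewrite inE; exact/eqP/H.
by case: eqP => [->|]; rewrite ?andbF.
Qed.

Lemma tensor_jacobi_active (c0 : R) k x : P 0 = c0%:P ->
  tensor_jacobi k x
  = (\prod_(i in active k) (P (k i)).[tnth x i]) * c0 ^+ (d - #|active k|).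
Proof.
move=> P0; rewrite /tensor_jacobi (bigID (mem (active k)))/=; congr (_ * _).
rewrite (eq_bigr (fun=> c0)) => [|i]; last first.
  by rewrite inE -eqn0Ngt => /eqP ->; rewrite P0 hornerC.
rewrite prodr_const; congr (_ ^+ _).
have /(canRL (addKn _)) := cardC (mem (active k)); rewrite card_ord => <-.
by apply: eq_card => i; rewrite !inE.
Qed.

(** The generators of the two spans differ by c0 to the number of inactive coordinates, a nonzero
    constant that is moved into the coefficients. *)
Lemma jacobi_spanE (m : nat) (c0 : R) : P 0 = c0%:P -> c0 != 0 ->
  jacobi_span P N m = [set g | exists c : multidegree -> R[i],
    forall x, g x = \sum_(k | low_order m k) c k * (tensor_jacobi k x)%:C].
Proof.
move=> P0 c0n.
have reidx (F : {set 'I_d} * multidegree -> R[i]) :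
    \sum_(uk | admissible m uk) F uk = \sum_(k | low_order m k) F (active k, k).
  rewrite (reindex_onto (fun k => (active k, k)) snd) => [|[u k]]; last first.
    by rewrite admissible_activeE /= => /andP[/eqP -> _].
  by apply: eq_bigl => k; rewrite admissible_activeE /= !eqxx andbT.
apply/seteqP; split => g /= [c gc].
  exists (fun k => c (active k, k) * ((c0 ^+ (d - #|active k|))^-1)%:C) => x.
  rewrite gc reidx; apply: eq_bigr => k _ /=.
  rewrite -mulrA -rmorphM/= (tensor_jacobi_active k x P0) mulrCA mulVf ?mulr1//.
  by rewrite expf_neq0.
exists (fun uk => c uk.2 * (c0 ^+ (d - #|active uk.2|))%:C) => x.
rewrite gc reidx; apply: eq_bigr => k _ /=.
by rewrite -mulrA -rmorphM/= (tensor_jacobi_active k x P0) (mulrC (c0 ^+ _)).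
Qed.

End tensor_jacobi.

Lemma weighted_innerE (R : realType) (d : nat) (alpha : R) (u g : euclid R d -> R[i]) :
  weighted_inner alpha u g =
  weighted_integral alpha
    (fun x => complex.Re (u x) * complex.Re (g x)
      + complex.Im (u x) * complex.Im (g x)) +i*
  weighted_integral alpha
    (fun x => complex.Im (u x) * complex.Re (g x) - complex.Re (u x)
      * complex.Im (g x)).
Proof.
rewrite /weighted_inner /cintegral /weighted_integral.
congr (_ +i* _); apply: eq_Rintegral => x _.
  by rewrite ReMreal; case: (u x) (g x) => a b [a' b'] /=; ring.
by rewrite ImMreal; case: (u x) (g x) => a b [a' b'] /=; ring.
Qed.

Section jacobi_projection.
Variables (R : realType) (d N m : nat) (alpha : R) (P : nat -> {poly R}).
Hypothesis orthoP : orthonormal_jacobi alpha P.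
Local Notation multidegree := {ffun 'I_d -> 'I_N.+1}.
Local Notation Phi := (@tensor_jacobi R d N P).
Local Notation I := (weighted_integral alpha).
Let wi := orthonormal_weight_integrable orthoP.
Let bPhi := @cube_bounded_tensor_jacobi R d N P.

Lemma weighted_integral_sub_coef (h : euclid R d -> R) (k : multidegree) :
  cube_bounded h -> low_order m k ->
  I (fun x => (h x - \sum_(l | low_order m l) I (fun x => h x * Phi l x) * Phi l x)
    * Phi k x) = 0.
Proof.
move=> bh mk.
have bg : cube_bounded (fun x => \sum_(l | low_order m l) I (fun x => h x
  * Phi l x) * Phi l x).
  by apply: cube_bounded_sum => l; apply: cube_boundedZ.
rewrite (_ : (fun x => _) = fun x => h x * Phi k x
   + (-1) * \sum_(l | low_order m l) I (fun x => h x * Phi l x) * (Phi l x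
     * Phi k x)); last first.
  apply/funext => x; rewrite mulrBl mulN1r mulr_suml; congr (_ - _).
  by apply: eq_bigr => l _; rewrite mulrA.
have bPP l : cube_bounded (fun x => I (fun x => h x * Phi l x) * (Phi l x * Phi k x)).
  by apply: cube_boundedZ; exact: cube_boundedM.
rewrite weighted_integralD//; last 2 first.
- exact: cube_boundedM.
- by apply: cube_boundedZ; exact: cube_bounded_sum.
rewrite weighted_integralZ//; last exact: cube_bounded_sum.
rewrite weighted_integral_sum// (bigD1 k)//= big1 => [|l /andP[_ lk]]; last first.
  rewrite weighted_integralZ//; last exact: cube_boundedM.
  by rewrite (tensor_jacobi_orthonormal _ _ orthoP) (negbTE lk) mulr0.
rewrite weighted_integralZ//; last exact: cube_boundedM.
by rewrite (tensor_jacobi_orthonormal _ _ orthoP) eqxx mulr1 addr0 mulN1r subrr.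
Qed.

Lemma weighted_integral_span0 (h : euclid R d -> R) (c : multidegree -> R) :
  cube_bounded h ->
  (forall k, low_order m k -> I (fun x => h x * Phi k x) = 0) ->
  I (fun x => h x * \sum_(k | low_order m k) c k * Phi k x) = 0.
Proof.
move=> bh h0; rewrite (_ : (fun x => _) = fun x => \sum_(k | low_order m k) c k
  * (h x * Phi k x)); last first.
  by apply/funext => x; rewrite mulr_sumr; apply: eq_bigr => k _; rewrite mulrCA.
rewrite weighted_integral_sum// => [|k]; last by apply: cube_boundedZ;
  exact: cube_boundedM.
rewrite big1// => k mk; rewrite weighted_integralZ ?h0 ?mulr0//.
exact: cube_boundedM.
Qed.

(** Turns the projection into explicit coefficients and two real orthogonality relations: testing
    against the real functions [Phi k] separates the real and imaginary parts. *)
Lemma jacobi_projectionP (f : euclid R d -> R[i]) :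
  cube_bounded (fun x => complex.Re (f x)) ->
  cube_bounded (fun x => complex.Im (f x)) ->
  exists c : multidegree -> R[i],
    (forall x, jacobi_projection alpha P N m f x
      = \sum_(k | low_order m k) c k * (Phi k x)%:C) /\
    forall k, low_order m k ->
      I (fun x => (complex.Re (f x) - \sum_(l | low_order m l) complex.Re (c l)
        * Phi l x) * Phi k x) = 0 /\
      I (fun x => (complex.Im (f x) - \sum_(l | low_order m l) complex.Im (c l)
        * Phi l x) * Phi k x) = 0.
Proof.
move=> bre bim.
have [c0 P0 c0n] := orthonormal_jacobi0 orthoP.
have spanE := jacobi_spanE d N m P0 c0n.
have ReE (c : multidegree -> R[i]) x
  : complex.Re (\sum_(k | low_order m k) c k * (Phi k x)%:C)
    = \sum_(k | low_order m k) complex.Re (c k) * Phi k x.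
  by rewrite Re_sum; apply: eq_bigr => k _; rewrite ReMreal.
have ImE (c : multidegree -> R[i]) x
  : complex.Im (\sum_(k | low_order m k) c k * (Phi k x)%:C)
    = \sum_(k | low_order m k) complex.Im (c k) * Phi k x.
  by rewrite Im_sum; apply: eq_bigr => k _; rewrite ImMreal.
have bsum (c : multidegree -> R) : cube_bounded (fun x => \sum_(k | low_order m k) c
  k * Phi k x).
  by apply: cube_bounded_sum => k; exact: cube_boundedZ.
pose b k := I (fun x => complex.Re (f x)
  * Phi k x) +i* I (fun x => complex.Im (f x) * Phi k x).
pose q0 (x : euclid R d) := \sum_(k | low_order m k) b k * (Phi k x)%:C.
set A := [set q | jacobi_span P N m q /\ forall g, jacobi_span P N m g ->
      weighted_inner alpha (fun x => f x - q x) g = 0].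
(* [xget] would return its default 0 on an empty set, so the expansion [q0] of f is exhibited as a
   member first. *)
have : A (jacobi_projection alpha P N m f).
  apply: (@xgetPex _ (cst 0)); exists q0; split.
    by rewrite spanE; exists b.
  move=> g; rewrite spanE => -[c gc].
  have gE : g = fun x => \sum_(k | low_order m k) c k * (Phi k x)%:C by apply/funext.
  rewrite weighted_innerE.
  set u := fun x => complex.Re (f x) - \sum_(l | low_order m l) I (fun x =>
    complex.Re (f x) * Phi l x) * Phi l x.
  set v := fun x => complex.Im (f x) - \sum_(l | low_order m l) I (fun x =>
    complex.Im (f x) * Phi l x) * Phi l x.
  have bu : cube_bounded u by apply: cube_boundedB => //; exact: bsum.
  have bv : cube_bounded v by apply: cube_boundedB => //; exact: bsum.
  have uE x : complex.Re (f x - q0 x) = u x by rewrite ReB ReE.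
  have vE x : complex.Im (f x - q0 x) = v x by rewrite ImB ImE.
  have u0 k : low_order m k -> I (fun x => u x * Phi k x) = 0.
    by move=> mk; exact: weighted_integral_sub_coef.
  have v0 k : low_order m k -> I (fun x => v x * Phi k x) = 0.
    by move=> mk; exact: weighted_integral_sub_coef.
  have -> : (fun x => complex.Re (f x - q0 x) * complex.Re (g x)
      + complex.Im (f x - q0 x) * complex.Im (g x))
    = fun x => u x * (\sum_(k | low_order m k) complex.Re (c k) * Phi k x)
      + v x * (\sum_(k | low_order m k) complex.Im (c k) * Phi k x).
    by apply/funext => x; rewrite uE vE gE ReE ImE.
  have -> : (fun x => complex.Im (f x - q0 x) * complex.Re (g x)
      - complex.Re (f x - q0 x) * complex.Im (g x))
    = fun x => v x * (\sum_(k | low_order m k) complex.Re (c k) * Phi k x)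
      + (-1) * (u x * (\sum_(k | low_order m k) complex.Im (c k) * Phi k x)).
    by apply/funext => x; rewrite uE vE gE ReE ImE mulN1r.
  rewrite !weighted_integralD//; try exact: cube_boundedM; last first.
    by apply: cube_boundedZ; exact: cube_boundedM.
  rewrite weighted_integralZ//; last exact: cube_boundedM.
  by rewrite !weighted_integral_span0// mulr0 addr0.
case=> qs orth; move: qs; rewrite spanE => -[c qc]; exists c; split => // k mk.
have Phispan : jacobi_span P N m (fun x => (Phi k x)%:C).
  rewrite spanE; exists (fun l => (l == k)%:R) => x.
  rewrite (bigD1 k)//= eqxx mul1r big1 ?addr0// => l /andP[_ /negbTE ->].
  by rewrite mul0r.
have := orth _ Phispan; rewrite weighted_innerE => -[].
move=> h1 h2; split.
  rewrite -[RHS]h1; congr (weighted_integral _ _); apply/funext => x.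
  by rewrite mulr0 addr0 ReB qc ReE.
rewrite -[RHS]h2; congr (weighted_integral _ _); apply/funext => x.
by rewrite mulr0 subr0 ImB qc ImE.
Qed.

End jacobi_projection.

(** For a fixed active set S the constraint on k is coordinatewise (k_j > 0 exactly for j in S), so
    the sum over k factors. This is how a bound on the number of active coordinates becomes a sum of
    products. *)
Lemma sum_active_distr (V : comNzRingType) (d N m : nat) (F : 'I_d -> 'I_N.+1 -> V) :
  \sum_(k : {ffun 'I_d -> 'I_N.+1} | (#|active k| <= m)%N) \prod_(j < d) F j (k j)
  = \sum_(S : {set 'I_d} | (#|S| <= m)%N)
      \prod_(j < d) \sum_(i < N.+1 | (0 < i)%N == (j \in S)) F j i.
Proof.
rewrite (partition_big (@active d N) (fun S => #|S| <= m)%N)//=.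
apply: eq_bigr => S Sm; rewrite bigA_distr_big_dep; apply: eq_bigl => k.
apply/andP/familyP => [[_ /eqP <-] j|kS]; first by rewrite unfold_in inE.
have -> : active k = S by apply/setP => j; rewrite inE; have := kS j;
  rewrite unfold_in => /eqP.
by rewrite Sm eqxx.
Qed.

Lemma sum_active_le (R : realType) (d m : nat) (G : {set 'I_d} -> R) (c : R) : 0 <= c ->
  (forall S : {set 'I_d}, (#|S| <= m)%N -> G S <= c) ->
  \sum_(S : {set 'I_d} | (#|S| <= m)%N) G S <= 2 ^+ d * c.
Proof.
move=> c0 Gc; apply: (@le_trans _ _ (\sum_(S : {set 'I_d}) c)).
  rewrite big_mkcond; apply: ler_sum => S _; case: ifP => //; exact: Gc.
rewrite sumr_const (_ : #|_| = 2 ^ d)%N.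
  by rewrite -natrX mulr_natl.
by rewrite -cardsT -powersetT card_powerset cardsT card_ord.
Qed.

(** The terms being nonnegative, the degree constraint may be dropped. An inactive coordinate then
    contributes at most B and an active one at most B Y, with at most m active ones. *)
Lemma tensor_christoffel (R : realType) (d N m : nat) (P : nat -> {poly R}) (B Y : R)
    (x : euclid R d) : 1 <= B -> 1 <= Y ->
  (forall j, (P 0).[tnth x j] ^+ 2 <= B) ->
  (forall j, \sum_(i < N.+1) (P i).[tnth x j] ^+ 2 <= B * Y) ->
  \sum_(k : {ffun 'I_d -> 'I_N.+1} | low_order m k) tensor_jacobi P k x ^+ 2
    <= 2 ^+ d * (B ^+ d * Y ^+ m).
Proof.
move=> B1 Y1 P0B PBY; have B0 : 0 <= B by rewrite (le_trans _ B1).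
have Y0 : 0 <= Y by rewrite (le_trans _ Y1).
apply: (@le_trans _ _ (\sum_(k : {ffun 'I_d -> 'I_N.+1} | (#|active k| <= m)%N)
    \prod_(j < d) (P (k j)).[tnth x j] ^+ 2)).
  rewrite big_mkcond [leRHS]big_mkcond; apply: ler_sum => k _.
  rewrite /low_order /tensor_jacobi prodrXl; case: (_ <= m)%N => //=.
  by case: ifP => // _; exact: sqr_ge0.
rewrite (sum_active_distr m (fun j (i : 'I_N.+1) => (P i).[tnth x j] ^+ 2)).
apply: sum_active_le; first by rewrite mulr_ge0 ?exprn_ge0.
move=> S Sm.
apply: (@le_trans _ _ (\prod_(j < d) (B * (if j \in S then Y else 1)))).
  apply: ler_prod => j _; rewrite sumr_ge0/= => [|i _]; last exact: sqr_ge0.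
  case: ifP => jS.
    rewrite (le_trans _ (PBY j))// big_mkcond; apply: ler_sum => i _.
    by case: ifP => // _; exact: sqr_ge0.
  rewrite mulr1 (le_trans _ (P0B j))// (bigD1 ord0)//= big1 ?addr0// => i.
  by rewrite -lt0n => /andP[/eqP]; case: (0 < i)%N.
rewrite big_split/= prodr_const card_ord -big_mkcond/= prodr_const.
by rewrite ler_wpM2l ?exprn_ge0// ler_weXn2l.
Qed.

(** [gam] is the tensor product of the univariate expansions. In the low-order part, 16 = 2 * 8:
    there are at most 2^d active sets, and each coordinate contributes at most 4 (its degree-0
    component) or 4 + 4 (the full value minus that component). *)
Lemma tensor_approximant (R : realType) (alpha : R) (d N m n : nat) (P : nat
  -> {poly R})
    (A B : 'I_d -> {poly R}) :
  orthonormal_jacobi alpha P -> (0 < d)%N -> (d * n <= N)%N ->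
  (forall j, size (A j) <= n)%N -> (forall j, size (B j) <= n)%N ->
  (forall j x, -1 <= x <= 1 -> `|(A j).[x]| <= 2) ->
  (forall j x, -1 <= x <= 1 -> `|(B j).[x]| <= 2) ->
  exists gam : {ffun 'I_d -> 'I_N.+1} -> R[i], forall x : euclid R d, cube (-1) 1 x ->
    \sum_k gam k * (tensor_jacobi P k x)%:C
      = \prod_(j < d) ((A j).[tnth x j] +i* (B j).[tnth x j]) /\
    normc (\sum_(k | low_order m k) gam k * (tensor_jacobi P k x)%:C) <= 16 ^+ d.
Proof.
move=> oP d0 dnN sA sB A2 B2.
have wi := orthonormal_weight_integrable oP.
pose L := weighted_mean alpha.
(* From index n on the coefficients vanish by orthogonality; here they are set to 0 outright. *)
pose cf (j : 'I_d) (i : 'I_N.+1) : R[i] :=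
  if (i < n)%N then L (A j * P i) +i* L (B j * P i) else 0.
exists (fun k => \prod_(j < d) cf j (k j)) => x cx.
have xj j : -1 <= tnth x j <= 1 by have := cx j; rewrite /= in_itv.
pose F (j : 'I_d) (i : 'I_N.+1) : R[i] := cf j i * ((P i).[tnth x j])%:C.
have FE (k : {ffun 'I_d -> 'I_N.+1})
  : \prod_(j < d) cf j (k j) * (tensor_jacobi P k x)%:C = \prod_(j < d) F j (k j).
  by rewrite /tensor_jacobi rmorph_prod -big_split.
have nN : (n <= N.+1)%N by rewrite (leq_trans _ (leqW dnN))// leq_pmull.
have FAB j : \sum_i F j i = (A j).[tnth x j] +i* (B j).[tnth x j].
  have expand (C : {poly R}) : (size C <= n)%N ->
      C.[tnth x j] = \sum_(i < N.+1 | (i < n)%N) L (C * P i) * (P i).[tnth x j].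
    move=> sC; rewrite {1}(orthonormal_jacobi_expand oP sC) horner_sum.
    rewrite (big_ord_widen _ (fun i => (L (C * P i) *: P i).[tnth x j]) nN).
    by apply: eq_bigr => i _; rewrite hornerZ.
  have FE' i : F j i = (if (i < n)%N then L (A j * P i) * (P i).[tnth x j] else 0)
                    +i* (if (i < n)%N then L (B j * P i) * (P i).[tnth x j] else 0).
    by rewrite /F /cf; case: ifP => _; [apply/eqP;
      rewrite eq_complex ReMreal ImMreal !eqxx|rewrite mul0r].
  apply/eqP; rewrite eq_complex Re_sum Im_sum/= (expand _ (sA j)) (expand _ (sB j)).
  by rewrite !(big_mkcond (fun i : 'I_N.+1 => (i < n)%N)); apply/andP; split;
    apply/eqP; apply: eq_bigr => i _; rewrite FE'.
split.
  by under eq_bigr do rewrite FE; rewrite -(bigA_distr_bigA F); apply: eq_bigr => j _.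
have -> : \sum_(k | low_order m k) \prod_(j < d) cf j (k j) * (tensor_jacobi P k x)%:C
    = \sum_(k : {ffun 'I_d -> 'I_N.+1} | (#|active k| <= m)%N) \prod_(j < d) F j (k j).
  rewrite big_mkcond [RHS]big_mkcond; apply: eq_bigr => k _; rewrite FE /low_order.
  case: (_ <= m)%N => //=; case: ifPn => // kN.
  (* If all k_j < n, the degree is at most d n <= N. So a multidegree above N has an entry at least
     n, where [cf] is 0, and only the order constraint truncates. *)
  have [j nj] : exists j, (n <= k j)%N.
    apply/existsP; apply: contraR kN => /existsPn H.
    apply: leq_trans dnN; rewrite -[d in X in (_ <= X)%N]card_ord -sum_nat_const.
    by apply: leq_sum => j _; apply: ltnW; rewrite ltnNge H.
  by rewrite (bigD1 j)//= /F /cf ltnNge nj/= !mul0r.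
rewrite sum_active_distr (le_trans (normc_sum _ _ _))//.
rewrite (_ : 16 ^+ d = 2 ^+ d * 8 ^+ d); last by rewrite -exprMn; congr (_ ^+ _); ring.
apply: sum_active_le; first exact: exprn_ge0.
move=> S _; rewrite normc_prod -[d in X in _ <= X]card_ord -prodr_const.
apply: ler_prod => j _; rewrite normc_ge0/=.
have F0 : normc (F j ord0) <= 4.
  rewrite /F /cf; case: ifP => _; last by rewrite mul0r normc0.
  rewrite (le_trans (normc_le_ReIm _))// ReMreal ImMreal/= (_ : 4 = 2 + 2);
    last by ring.
  by apply: lerD; apply: (orthonormal_jacobi_mean_term oP) => y; [exact: A2|exact: B2].
case: (boolP (j \in S)) => jS.
  have -> : \sum_(i < N.+1 | (0 < i)%N == true) F j i = \sum_i F j i - F j ord0.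
    rewrite [X in _ = X - _](bigD1 ord0)//= addrC addrK; apply: eq_bigl => i.
    by rewrite eqb_id -lt0n.
  rewrite (le_trans (normcB _ _))// (_ : 8 = 4 + 4); last by ring.
  apply: lerD => //; rewrite FAB (le_trans (normc_le_ReIm _))//=.
  by rewrite (_ : 4 = 2 + 2) ?lerD ?A2 ?B2//; ring.
have -> : \sum_(i < N.+1 | (0 < i)%N == false) F j i = F j ord0.
  rewrite (bigD1 ord0)//= big1 ?addr0// => i.
  by rewrite -lt0n => /andP[/eqP ->].
by rewrite (le_trans F0)// ler_nat.
Qed.

(** * Exponentials in the tensor Jacobi basis *)

Lemma cis_sum (R : realType) (I : Type) (s : seq I) (th : I -> R) :
  cos (\sum_(i <- s) th i) +i* sin (\sum_(i <- s) th i)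
  = \prod_(i <- s) (cos (th i) +i* sin (th i)) :> R[i].
Proof.
elim: s => [|i s IH]; first by rewrite !big_nil cos0 sin0.
rewrite !big_cons -IH cosD sinD; apply/eqP; rewrite eq_complex /=; apply/andP;
  split => //.
by apply/eqP; ring.
Qed.

Lemma trig_prod (R : realType) (d : nat) (p : d.-tuple int) (x : euclid R d) :
  trig p x = \prod_(j < d) (cos (2 * pi * (tnth p j)%:~R * tnth x j)
                            +i* sin (2 * pi * (tnth p j)%:~R * tnth x j)).
Proof.
rewrite /trig mulr_sumr cis_sum; apply: eq_bigr => j _.
by rewrite !mulrA.
Qed.

Lemma normc_cis (R : realType) (x : R) : normc (cos x +i* sin x) = 1.
Proof. by rewrite /= cos2Dsin2 sqrtr1. Qed.

Lemma normc_trig (R : realType) (d : nat) (p : d.-tuple int) (x : euclid R d) :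
  normc (trig p x) = 1.
Proof. exact: normc_cis. Qed.

(** As K dominates 2 pi e^2 and K M <= n, each frequency 2 pi p_j meets the degree requirement of
    [trigo_taylor]. *)
Lemma trig_approximant (R : realType) (alpha : R) (d N m n K M : nat) (P : nat
  -> {poly R})
    (p : d.-tuple int) :
  orthonormal_jacobi alpha P -> (0 < d)%N -> (d * n <= N)%N ->
  expR 2 * (2 * pi) <= K%:R :> R -> (K * M <= n)%N ->
  (forall j, `|tnth p j| <= M)%N ->
  exists gam : {ffun 'I_d -> 'I_N.+1} -> R[i], forall x : euclid R d, cube (-1) 1 x ->
    normc (trig p x - \sum_k gam k * (tensor_jacobi P k x)%:C)
      <= d%:R * 4 ^+ d * (2 * expR (- n%:R)) /\
    normc (\sum_(k | low_order m k) gam k * (tensor_jacobi P k x)%:C) <= 16 ^+ d.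
Proof.
move=> oP d0 dnN K2pi KM pM.
pose c (j : 'I_d) : R := 2 * pi * (tnth p j)%:~R.
have p2 : 0 <= 2 * pi :> R by rewrite mulr_ge0// ltW// pi_gt0.
have cn j : expR 2 * `|c j| <= n%:R.
  rewrite normrM (ger0_norm p2) mulrA -intr_norm -natr_absz.
  apply: (@le_trans _ _ (K%:R * M%:R)); last by rewrite -natrM ler_nat.
  apply: ler_pM => //; first by rewrite mulr_ge0 ?expR_ge0.
  by rewrite ler_nat pM.
have /choice[A /choice[B AB]] := fun j => trigo_taylor (cn j).
have e1 : expR (- n%:R) <= 1 :> R by rewrite expR_le1 oppr_le0.
have le2 (u v : R) : `|u| <= 1 -> `|u - v| <= expR (- n%:R) -> `|v| <= 2.
  move=> u1 uv; rewrite -[v](subKr u) (le_trans (ler_normB _ _))//.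
  by rewrite (_ : 2 = 1 + 1) ?lerD// 1?(le_trans uv)//; ring.
have A2 j x : -1 <= x <= 1 -> `|(A j).[x]| <= 2.
  have [_ _ Ac _] := AB j.
  by move=> /Ac; apply: le2; rewrite ler_norml cos_geN1 cos_le1.
have B2 j x : -1 <= x <= 1 -> `|(B j).[x]| <= 2.
  have [_ _ _ Bs] := AB j.
  by move=> /Bs; apply: le2; rewrite ler_norml sin_geN1 sin_le1.
have [||gam gamP] := @tensor_approximant R alpha d N m n P A B oP d0 dnN _ _ A2 B2.
- by move=> j; have [] := AB j.
- by move=> j; have [] := AB j.
exists gam => x cx; have [-> T] := gamP x cx; split => //.
have xj j : -1 <= tnth x j <= 1 by have := cx j; rewrite /= in_itv.
rewrite trig_prod.
(* Each approximate factor has modulus at most 4 = 2 + 2 and error at most 2 e^(-n), one summand for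
   each of the real and imaginary parts. *)
have := @normc_prodB R 'I_d (index_enum 'I_d)
  (fun j => cos (c j * tnth x j) +i* sin (c j * tnth x j))
  (fun j => (A j).[tnth x j] +i* (B j).[tnth x j]) 4 (2 * expR (- n%:R)).
have -> : size (index_enum 'I_d) = d by rewrite -sum1_size sum1_card card_ord.
apply.
- by rewrite ler1n.
- by rewrite mulr_ge0// expR_ge0.
- by move=> j; rewrite normc_cis ler1n.
- move=> j; rewrite (le_trans (normc_le_ReIm _))//=.
  by rewrite (_ : 4 = 2 + 2) ?lerD ?A2 ?B2//; ring.
- move=> j; rewrite (le_trans (normc_le_ReIm _))// ReB ImB mulr2n mulrDl mul1r.
  have [_ _ Ac Bs] := AB j.
  by apply: lerD; [exact: Ac|exact: Bs].
Qed.

Lemma int_box (d M : nat) : exists2 s : seq (d.-tuple int), uniq s &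
  forall p, (p \in s) = [forall j, `|tnth p j| <= M]%N.
Proof.
pose phi (f : {ffun 'I_d -> 'I_(M + M).+1}) : d.-tuple int
  := [tuple (f j)%:Z - M%:Z | j < d].
have phi_inj : injective phi.
  move=> f h fh; apply/ffunP => j; apply/val_inj.
  have := congr1 (fun t => tnth t j) fh; rewrite !tnth_mktuple.
  by move=> /addIr [].
exists (map phi (enum {ffun 'I_d -> 'I_(M + M).+1})).
  by rewrite map_inj_uniq// enum_uniq.
move=> p; apply/mapP/forallP => [[f _ ->] j|pM].
  rewrite tnth_mktuple; case: (f j) => q qM. move: qM; rewrite /=; lia.
exists [ffun j => inord `|tnth p j + M%:Z|]; first by rewrite mem_enum.
apply: eq_from_tnth => j; rewrite tnth_mktuple ffunE.
have {pM} := pM j; move: (tnth p j) => q qM.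
have qM0 : 0 <= q + M%:Z by lia.
by rewrite inordK; lia.
Qed.

(** The left side is the square of Pi (h0 - Q) at x, where Q is the full sum over [gam]: by
    orthonormality, projecting Q keeps exactly its low-order terms. Bessel bounds the coefficients c
    - gam by E^2 times the mass of the weight, and Cauchy-Schwarz brings in the kernel bound X. *)
Lemma projection_sub_approximant_le (R : realType) (alpha : R) (d N m : nat)
    (P : nat -> {poly R}) (h0 : euclid R d -> R) (c gam : {ffun 'I_d -> 'I_N.+1} -> R)
    (E X : R) (x : euclid R d) :
  orthonormal_jacobi alpha P -> cube_bounded h0 -> 0 <= E ->
  (forall k : {ffun 'I_d -> 'I_N.+1}, low_order m k -> weighted_integral alpha
     (fun y => (h0 y - \sum_(l : {ffun 'I_d
       -> 'I_N.+1} | low_order m l) c l * tensor_jacobi P l y)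
               * tensor_jacobi P k y) = 0) ->
  (forall y, cube (-1) 1 y -> `|h0 y - \sum_(l : {ffun 'I_d
    -> 'I_N.+1}) gam l * tensor_jacobi P l y| <= E) ->
  \sum_(k : {ffun 'I_d -> 'I_N.+1} | low_order m k) tensor_jacobi P k x ^+ 2 <= X ->
  (\sum_(k : {ffun 'I_d -> 'I_N.+1} | low_order m k) c k * tensor_jacobi P k x
   - \sum_(k : {ffun 'I_d -> 'I_N.+1} | low_order m k) gam k * tensor_jacobi P k x) ^+ 2
  <= E ^+ 2 * weighted_mean alpha 1 ^+ d * X.
Proof.
move=> oP bh E0 orth hE PX.
have wi := orthonormal_weight_integrable oP.
pose Phi := @tensor_jacobi R d N P.
have bPhi k : cube_bounded (Phi k) := cube_bounded_tensor_jacobi P k.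
have bPhiM k l : cube_bounded (fun y => Phi k y * Phi l y) by exact: cube_boundedM.
have bsum p (u : {ffun 'I_d -> 'I_N.+1}
  -> R) : cube_bounded (fun y => \sum_(k | p k) u k * Phi k y).
  by apply: cube_bounded_sum => k; exact: cube_boundedZ.
pose h y := h0 y - \sum_(l : {ffun 'I_d -> 'I_N.+1}) gam l * Phi l y.
have bh' : cube_bounded h by apply: cube_boundedB => //; exact: bsum.
have orthS (p : pred {ffun 'I_d -> 'I_N.+1}) (k : {ffun 'I_d -> 'I_N.+1}) : p k
  -> weighted_integral alpha (fun y => (\sum_(l | p l) gam l * Phi l y)
    * Phi k y) = gam k.
  move=> pk; rewrite (_ : (fun y => _) = fun y => \sum_(l | p l) gam l * (Phi l y
    * Phi k y)); last first.
    by apply/funext => y; rewrite mulr_suml; apply: eq_bigr => l _; rewrite mulrA.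
  rewrite weighted_integral_sum// => [|l]; last exact: cube_boundedZ.
  rewrite (bigD1 k)//= weighted_integralZ// (tensor_jacobi_orthonormal _ _ oP) eqxx
    mulr1.
  rewrite big1 ?addr0// => l /andP[_ lk].
  by rewrite weighted_integralZ// (tensor_jacobi_orthonormal _ _ oP) (negbTE lk) mulr0.
have orth' (k : {ffun 'I_d -> 'I_N.+1}) : low_order m k -> weighted_integral alpha
    (fun y => (h y - \sum_(l | low_order m l) (c l - gam l) * Phi l y) * Phi k y) = 0.
  move=> mk; rewrite (_ : (fun y => _) = fun y =>
     (h0 y - \sum_(l : {ffun 'I_d -> 'I_N.+1} | low_order m l) c l * Phi l y) * Phi k y
     + ((\sum_(l | low_order m l) gam l * Phi l y) * Phi k y
     + (-1) * ((\sum_(l : {ffun 'I_d -> 'I_N.+1}) gam l * Phi l y) * Phi k y)));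
       last first.
    apply/funext => y; rewrite /h.
    under [X in _ - X]eq_bigr do rewrite mulrBl.
    by rewrite sumrB; ring.
  have bh1 : cube_bounded (fun y => (h0 y - \sum_(l : {ffun 'I_d
    -> 'I_N.+1} | low_order m l) c l * Phi l y) * Phi k y).
    by apply: cube_boundedM => //; apply: cube_boundedB => //; exact: bsum.
  have bs (p : pred {ffun 'I_d -> 'I_N.+1})
    : cube_bounded (fun y => (\sum_(l | p l) gam l * Phi l y) * Phi k y).
    by apply: cube_boundedM => //; exact: bsum.
  rewrite !weighted_integralD//; try (by apply: cube_boundedZ; exact: bs).
    by rewrite weighted_integralZ ?orth ?orthS// add0r mulN1r subrr.
  by apply: cube_boundedD; [exact: bs|apply: cube_boundedZ; exact: bs].
have [bess _] := weighted_bessel wi bPhi (fun k l => tensor_jacobi_orthonormal k l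
  oP) bh' orth'.
rewrite -sumrB; under eq_bigr do rewrite -mulrBl.
rewrite (le_trans (Cauchy_Schwarz_sum _ _ _ _))//.
apply: ler_pM => //; try by apply: sumr_ge0 => k _; exact: sqr_ge0.
apply: (le_trans bess).
apply: (@le_trans _ _ (weighted_integral alpha (fun _ : euclid R d => E ^+ 2))).
  apply: le_weighted_integral => //; first exact: cube_boundedM.
    exact: cube_bounded_cst.
  move=> y cy; rewrite -[h y ^+ 2]real_normK ?num_real// lerXn2r ?nnegrE//.
  exact: hE.
rewrite weighted_integral_cst// /weighted_mean.
by under [in leRHS]eq_Rintegral do rewrite hornerC mul1r.
Qed.

(** The residual is a contraction of f, and |f| <= S is integrated against the total mass of the
    weight; the doubling comes from treating real and imaginary parts separately. *)
Lemma projection_weighted_error_le (R : realType) (alpha : R) (d N m : nat)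
    (P : nat -> {poly R}) (f : euclid R d -> R[i]) (S : R) :
  orthonormal_jacobi alpha P -> 0 <= S ->
  cube_bounded (fun x => complex.Re (f x)) ->
  cube_bounded (fun x => complex.Im (f x)) ->
  (forall x, cube (-1) 1 x -> normc (f x) <= S) ->
  (weighted_L2_norm alpha (fun x => f x - jacobi_projection alpha P N m f x)%R
    <= ((S ^+ 2 * weighted_mean alpha 1 ^+ d *+ 2) `^ 2^-1)%:E)%E.
Proof.
move=> oP S0 bre bim fS.
have wi := orthonormal_weight_integrable oP.
have [c [qc orth]] := jacobi_projectionP N m oP bre bim.
pose Phi := @tensor_jacobi R d N P.
have bPhi k : cube_bounded (Phi k) := cube_bounded_tensor_jacobi P k.
have oPhi (k l : {ffun 'I_d -> 'I_N.+1}) := tensor_jacobi_orthonormal k l oP.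
pose u x := complex.Re (f x) - \sum_(k | low_order m k) complex.Re (c k) * Phi k x.
pose v x := complex.Im (f x) - \sum_(k | low_order m k) complex.Im (c k) * Phi k x.
have Hre : weighted_integral alpha (fun x => u x ^+ 2)
    <= weighted_integral alpha (fun x => complex.Re (f x) ^+ 2).
  exact: (weighted_bessel wi bPhi oPhi bre (fun k mk => (orth k mk).1)).2.
have Him : weighted_integral alpha (fun x => v x ^+ 2)
    <= weighted_integral alpha (fun x => complex.Im (f x) ^+ 2).
  exact: (weighted_bessel wi bPhi oPhi bim (fun k mk => (orth k mk).2)).2.
have bu : cube_bounded u.
  by apply: cube_boundedB => //; apply: cube_bounded_sum => k; exact: cube_boundedZ.
have bv : cube_bounded v.
  by apply: cube_boundedB => //; apply: cube_bounded_sum => k; exact: cube_boundedZ.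
have bu2 : cube_bounded (fun x => u x ^+ 2) by exact: cube_boundedM.
have bv2 : cube_bounded (fun x => v x ^+ 2) by exact: cube_boundedM.
have errE x : normc (f x - jacobi_projection alpha P N m f x) ^+ 2 = u x ^+ 2
  + v x ^+ 2.
  rewrite sqr_normc ReB ImB qc Re_sum Im_sum /u /v.
  by congr ((_ - _) ^+ 2 + (_ - _) ^+ 2); apply: eq_bigr => k _;
    rewrite ?ReMreal ?ImMreal.
have part (w : euclid R d -> R) : cube_bounded w -> (forall x, cube (-1) 1 x
  -> `|w x| <= S) ->
    weighted_integral alpha (fun x => w x ^+ 2) <= S ^+ 2 * weighted_mean alpha 1 ^+ d.
  move=> bw wS; apply: (@le_trans _ _ (weighted_integral alpha (fun _
    : euclid R d => S ^+ 2))).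
    apply: le_weighted_integral => //; first exact: cube_boundedM.
      exact: cube_bounded_cst.
    by move=> y cy; rewrite -[w y ^+ 2]real_normK ?num_real// lerXn2r ?nnegrE// wS.
  rewrite weighted_integral_cst// /weighted_mean.
  by under [in leRHS]eq_Rintegral do rewrite hornerC mul1r.
rewrite /weighted_L2_norm.
have -> : (\int[lebesgue_tuple R d]_(x in cube (-1)%R 1%R)
    (normc (f x - jacobi_projection alpha P N m f x)%R ^+ 2
      * jacobi_weight alpha x)%:E)%E
  = (weighted_integral alpha (fun x => u x ^+ 2 + v x ^+ 2))%:E.
  rewrite /weighted_integral /Rintegral fineK.
    by apply: eq_integral => x _; rewrite errE.
  apply: integrable_fin_num; first exact: measurable_cube.
  by apply: integrable_weighted => //; exact: cube_boundedD.
rewrite poweR_EFin lee_fin ge0_ler_powR ?nnegrE ?invr_ge0//.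
- by apply: weighted_integral_ge0 => x; rewrite addr_ge0 ?sqr_ge0.
- by rewrite mulrn_wge0// mulr_ge0 ?sqr_ge0// exprn_ge0// ltW// (weighted_mean1_gt0 oP).
rewrite weighted_integralD// mulr2n lerD//.
  apply: (le_trans Hre); apply: part => // x cx.
  exact: le_trans (normr_Re_le _) (fS x cx).
apply: (le_trans Him); apply: part => // x cx.
exact: le_trans (normr_Im_le _) (fS x cx).
Qed.

Lemma fourier_expanded_normc_le (R : realType) (d : nat) (f : euclid R d
  -> R[i]) (S : R)
    (x : euclid R d) :
  fourier_expanded f ->
  (forall B : seq (d.-tuple int), uniq B
    -> \sum_(p <- B) normc (fourier_coef f p) <= S) ->
  normc (f x) <= S.
Proof.
move=> fE fS; apply/ler_addgt0Pr => e e0.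
have [A /(_ A (fsubset_refl _)) fA] := fE x e e0.
rewrite -[f x](subrK (\sum_(p <- A) fourier_coef f p * trig p x)).
rewrite (le_trans (normcD _ _))// addrC lerD ?(ltW fA)//.
rewrite (le_trans (normc_sum _ _ _))//.
under eq_bigr do rewrite normcM normc_trig mulr1.
exact: fS (fset_uniq A).
Qed.

(** Inside the box each exponential is replaced by its approximant at cost e; the frequencies
    outside have an entry above M and fall under tau. *)
Lemma fourier_expanded_approximant_le (R : realType) (d M : nat) (f : euclid R d
  -> R[i])
    (g : d.-tuple int -> R[i]) (S tau e : R) (s : seq (d.-tuple int)) (x : euclid R d) :
  fourier_expanded f -> 0 <= e ->
  uniq s -> (forall p, (p \in s) = [forall j, `|tnth p j| <= M]%N) ->
  (forall B : seq (d.-tuple int), uniq B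
    -> \sum_(p <- B) normc (fourier_coef f p) <= S) ->
  (forall B : seq (d.-tuple int), uniq B ->
    (forall p, p \in B -> exists j, (M < `|tnth p j|)%N) ->
    \sum_(p <- B) normc (fourier_coef f p) <= tau) ->
  (forall p, p \in s -> normc (trig p x - g p) <= e) ->
  normc (f x - \sum_(p <- s) fourier_coef f p * g p) <= tau + e * S.
Proof.
move=> fE e0 us sM fS ftau sg; apply/ler_addgt0Pr => eps eps0.
have [A fA] := fE x eps eps0.
(* Unconditional summation permits any finite superset of A, in particular one containing the
   box. *)
pose B := (A `|` [fset p in s])%fset.
have {}fA := fA B (fsubsetUl _ _).
have sB p : p \in s -> p \in B by move=> ps; rewrite in_fsetU !inE/= ps orbT.
have uB := fset_uniq B.
have pm : perm_eq [seq p <- B | p \in s] s.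
  apply: uniq_perm => //; first exact: filter_uniq.
  by move=> p; rewrite mem_filter; case: (boolP (p \in s)) => //= /sB.
have split (F : d.-tuple int -> R[i]) : \sum_(p <- B) F p
    = \sum_(p <- s) F p + \sum_(p <- [seq p <- B | p \notin s]) F p.
  by rewrite (bigID (mem s))/= -big_filter (perm_big _ pm)/= big_filter.
rewrite (_ : f x - _ = (f x - \sum_(p <- B) fourier_coef f p * trig p x)
   + (\sum_(p <- s) fourier_coef f p * (trig p x - g p)
   + \sum_(p <- [seq p <- B | p \notin s]) fourier_coef f p * trig p x)); last first.
  under [X in _ = _ + (X + _)]eq_bigr do rewrite mulrBr.
  by rewrite sumrB split; ring.
rewrite (le_trans (normcD _ _))// addrC lerD ?(ltW fA)//.
rewrite (le_trans (normcD _ _))// addrC; apply: lerD.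
  rewrite (le_trans (normc_sum _ _ _))//.
  under eq_bigr do rewrite normcM normc_trig mulr1.
  apply: ftau; first exact: filter_uniq.
  move=> p; rewrite mem_filter sM => /andP[/forallPn[j]].
  by rewrite -ltnNge => Mj _; exists j.
rewrite (le_trans (normc_sum _ _ _))//.
apply: (@le_trans _ _ (\sum_(p <- s) e * normc (fourier_coef f p))).
  rewrite big_seq [leRHS]big_seq; apply: ler_sum => p ps.
  by rewrite normcM mulrC ler_wpM2r ?normc_ge0 ?sg.
by rewrite -mulr_sumr ler_wpM2l ?fS.
Qed.

(** With T the low-order part of the approximant Q, f - Pi f = f - T - (Pi f - T). The first two
    terms are at most S and 16^d S. The last is Pi (f - Q), bounded by
    [projection_sub_approximant_le] for the real and the imaginary part, hence the factor 2. *)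
Lemma projection_sup_error_le (R : realType) (alpha : R) (d N m n K M : nat)
    (P : nat -> {poly R}) (f : euclid R d -> R[i]) (S tau B Y : R) (x : euclid R d) :
  orthonormal_jacobi alpha P -> (0 < d)%N -> (d * n <= N)%N ->
  expR 2 * (2 * pi) <= K%:R :> R -> (K * M <= n)%N ->
  1 <= B -> 1 <= Y ->
  (forall y, -1 <= y <= 1 -> (P 0).[y] ^+ 2 <= B) ->
  (forall y, -1 <= y <= 1 -> \sum_(i < N.+1) (P i).[y] ^+ 2 <= B * Y) ->
  measurable_fun setT (fun x => complex.Re (f x)) ->
  measurable_fun setT (fun x => complex.Im (f x)) ->
  fourier_expanded f -> 0 <= S -> 0 <= tau ->
  (forall s : seq (d.-tuple int), uniq s
    -> \sum_(p <- s) normc (fourier_coef f p) <= S) ->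
  (forall s : seq (d.-tuple int), uniq s ->
    (forall p, p \in s -> exists j, (M < `|tnth p j|)%N) ->
    \sum_(p <- s) normc (fourier_coef f p) <= tau) ->
  cube (-1) 1 x ->
  normc (f x - jacobi_projection alpha P N m f x)
  <= (1 + 16 ^+ d) * S
     + 2 * Num.sqrt ((tau + d%:R * 4 ^+ d * (2 * expR (- n%:R)) * S) ^+ 2
         * weighted_mean alpha 1 ^+ d * (2 ^+ d * (B ^+ d * Y ^+ m))).
Proof.
move=> oP d0 dnN K2pi KM B1 Y1 P0B PBY mre mim fE S0 tau0 fS ftau cx.
pose Phi := @tensor_jacobi R d N P.
pose e : R := d%:R * 4 ^+ d * (2 * expR (- n%:R)).
have e0 : 0 <= e by rewrite !mulr_ge0 ?exprn_ge0 ?expR_ge0.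
have fS' y : normc (f y) <= S by exact: fourier_expanded_normc_le.
have bre : cube_bounded (fun x => complex.Re (f x)).
  by split => //; exists S => y _; exact: le_trans (normr_Re_le _) (fS' y).
have bim : cube_bounded (fun x => complex.Im (f x)).
  by split => //; exists S => y _; exact: le_trans (normr_Im_le _) (fS' y).
have [c [qc orth]] := jacobi_projectionP N m oP bre bim.
have [s us sM] := int_box d M.
have /choice[gam gamP] : forall p, exists g : {ffun 'I_d -> 'I_N.+1} -> R[i], p \in s ->
    forall y : euclid R d, cube (-1) 1 y ->
    normc (trig p y - \sum_k g k * (Phi k y)%:C) <= e /\
    normc (\sum_(k | low_order m k) g k * (Phi k y)%:C) <= 16 ^+ d.
  move=> p; have [ps|] := boolP (p \in s); last by exists (fun=> 0).
  have [|g gP] := @trig_approximant R alpha d N m n K M P p oP d0 dnN K2pi KM.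
    by move: ps; rewrite sM => /forallP.
  by exists g.
(* The coefficients of Q: the approximants of the exponentials in the box, combined with the Fourier
   coefficients of f. *)
pose Gam (k : {ffun 'I_d -> 'I_N.+1}) := \sum_(p <- s) fourier_coef f p * gam p k.
have GamE (A : pred {ffun 'I_d -> 'I_N.+1}) y : \sum_(k | A k) Gam k * (Phi k y)%:C
    = \sum_(p <- s) fourier_coef f p * \sum_(k | A k) gam p k * (Phi k y)%:C.
  under eq_bigr do rewrite mulr_suml.
  rewrite exchange_big/=; apply: eq_bigr => p _; rewrite mulr_sumr.
  by apply: eq_bigr => k _; rewrite mulrA.
have fQ y : cube (-1) 1 y -> normc (f y - \sum_k Gam k * (Phi k y)%:C) <= tau + e * S.
  move=> cy; rewrite GamE; apply: (fourier_expanded_approximant_le fE e0 us sM fS ftau).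
  by move=> p ps; have [] := gamP p ps y cy.
have TQ : normc (\sum_(k | low_order m k) Gam k * (Phi k x)%:C) <= 16 ^+ d * S.
  rewrite GamE (le_trans (normc_sum _ _ _))//.
  apply: (@le_trans _ _ (\sum_(p <- s) 16 ^+ d * normc (fourier_coef f p))).
    rewrite big_seq [leRHS]big_seq; apply: ler_sum => p ps.
    by rewrite normcM mulrC ler_wpM2r ?normc_ge0//; have [] := gamP p ps x cx.
  by rewrite -mulr_sumr ler_wpM2l ?exprn_ge0 ?fS.
have xj j : -1 <= tnth x j <= 1 by have := cx j; rewrite /= in_itv.
have PX : \sum_(k : {ffun 'I_d -> 'I_N.+1} | low_order m k) Phi k x ^+ 2
    <= 2 ^+ d * (B ^+ d * Y ^+ m).
  by apply: tensor_christoffel => // j; [exact: P0B|exact: PBY].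
set E := tau + e * S; have E0 : 0 <= E by rewrite addr_ge0// mulr_ge0.
set X := 2 ^+ d * _ in PX *.
have ReE (A : pred {ffun 'I_d -> 'I_N.+1}) (u : {ffun 'I_d -> 'I_N.+1} -> R[i]) y :
    complex.Re (\sum_(k | A k) u k * (Phi k y)%:C) = \sum_(k | A k) complex.Re (u k)
      * Phi k y.
  by rewrite Re_sum; apply: eq_bigr => k _; rewrite ReMreal.
have ImE (A : pred {ffun 'I_d -> 'I_N.+1}) (u : {ffun 'I_d -> 'I_N.+1} -> R[i]) y :
    complex.Im (\sum_(k | A k) u k * (Phi k y)%:C) = \sum_(k | A k) complex.Im (u k)
      * Phi k y.
  by rewrite Im_sum; apply: eq_bigr => k _; rewrite ImMreal.
have hre := projection_sub_approximant_le oP bre E0 (fun k mk => (orth k mk).1)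
  (gam := fun k => complex.Re (Gam k)) _ PX.
have him := projection_sub_approximant_le oP bim E0 (fun k mk => (orth k mk).2)
  (gam := fun k => complex.Im (Gam k)) _ PX.
pose D := jacobi_projection alpha P N m f x - \sum_(k | low_order m k) Gam k
  * (Phi k x)%:C.
have D_le : normc D <= 2 * Num.sqrt (E ^+ 2 * weighted_mean alpha 1 ^+ d * X).
  rewrite (le_trans (normc_le_ReIm _))// mulr2n mulrDl mul1r /D qc ReB ImB !ReE !ImE.
  apply: lerD; rewrite -sqrtr_sqr ler_wsqrtr//.
    by apply: hre => y cy; rewrite -ReE -ReB (le_trans (normr_Re_le _))// fQ.
  by apply: him => y cy; rewrite -ImE -ImB (le_trans (normr_Im_le _))// fQ.
rewrite (_ : f x - _ = f x - \sum_(k | low_order m k) Gam k * (Phi k x)%:C - D);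
  last first.
  by rewrite /D; ring.
rewrite (le_trans (normcB _ _))// lerD//.
by rewrite (le_trans (normcB _ _))// mulrDl mul1r lerD.
Qed.

(** * The error bounds *)

(** With k + 1 >= a, (n + 1)^a <= (n + 1)^(k + 1) <= (k + 1)! e^(n + 1), by a single term of the
    exponential series. *)
Lemma powR_expRN_bounded (R : realType) (a : R) :
  exists2 C : R, 0 < C & forall n : nat, n.+1%:R `^ a * expR (- n%:R) <= C.
Proof.
pose k := Num.bound `|a|.
have ak : a <= k.+1%:R.
  rewrite (le_trans (ler_norm a))// (le_trans (ltW (archi_boundP _)))//.
  by rewrite ler_nat.
exists ((k.+1`!)%:R * expR 1); first by rewrite mulr_gt0 ?expR_gt0// ltr0n fact_gt0.
move=> n; have n1 : 1 <= n.+1%:R :> R by rewrite ler1n.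
have f0 : 0 < (k.+1`!)%:R :> R by rewrite ltr0n fact_gt0.
have h1 : n.+1%:R `^ a <= n.+1%:R ^+ k.+1 :> R.
  by rewrite -powR_mulrn//; exact: ler_powR.
have h2 : n.+1%:R ^+ k.+1 <= (k.+1`!)%:R * expR n.+1%:R :> R.
  rewrite -ler_pdivrMl// mulrC (le_trans _ (expR_ge1Dxn k (ler0n _ _)))//.
  by rewrite lerDr.
rewrite -ler_pdivlMr ?expR_gt0// -expRN opprK -mulrA -expRD.
by rewrite (le_trans h1)// (le_trans h2)// addrC natr1.
Qed.

(** Passing from N to N + 1 costs the power of 2, as N >= (N + 1) / 2; the other factors of D are at
    least 1. At alpha = -1/2 the claim is 1 <= 2. *)
Lemma D_const_ge (R : realType) (alpha : R) (N : nat) : - 2^-1 <= alpha -> (0 < N)%N ->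
  2 `^ (- (alpha + 2^-1)) * N.+1%:R `^ (alpha + 2^-1) <= D_const N alpha.
Proof.
move=> ha N0; rewrite /D_const; case: eqP => [->|_].
  by rewrite addNr oppr0 !powRr0 mulr1 ler1n.
have a0 : 0 <= alpha + 2^-1 by lra.
have N2 : N.+1%:R / 2 <= N%:R :> R.
  have : 1 <= N%:R :> R by rewrite ler1n.
  by rewrite -natr1; lra.
have h1 : 2 `^ (- (alpha + 2^-1)) * N.+1%:R `^ (alpha
  + 2^-1) = (N.+1%:R / 2) `^ (alpha + 2^-1) :> R.
  rewrite powRM ?invr_ge0// mulrC; congr (_ * _).
  by rewrite -(powR_inv1 (ler0n R 2)) -powRrM mulN1r.
rewrite h1 (@le_trans _ _ (N%:R `^ (alpha + 2^-1)))//.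
  by apply: ge0_ler_powR; rewrite ?nnegrE ?divr_ge0.
have pi1 : 1 <= pi :> R by rewrite (le_trans _ (pi_ge2 R))// ler1n.
have p1 : 1 <= pi `^ (3 / 4) :> R.
  have q0 : 0 <= 3 / 4 :> R by lra.
  by have := ler_powR pi1 q0; rewrite powRr0.
have e1 : 1 <= expR (alpha + 3 / 4) by rewrite (le_trans _ (expR_ge1Dx _))//; lra.
rewrite mulrAC ler_peMl ?powR_ge0//.
by rewrite mulr_ege1.
Qed.

(** Shows that the tail factor of the theorem dominates (N + 1)^(m - t); it is bounded below factor
    by factor, using m >= 1. *)
Lemma tail_factor_ge (R : realType) (t : R) (d N m : nat) :
  (0 < m)%N -> m%:R + 1 < t ->
  t^-1 * N.+1%:R `^ (- (t - m%:R))
  <= m%:R / (t - m%:R) * (2 + m%:R / N.+1%:R) ^+ d * (m%:R / N.+1%:R) `^ (t - m%:R).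
Proof.
move=> m0 mt; have m1 : 1 <= m%:R :> R by rewrite ler1n.
have N0 : 0 < N.+1%:R :> R by rewrite ltr0n.
have r0 : 0 <= m%:R / N.+1%:R :> R by rewrite divr_ge0.
have tm0 : 0 < t - m%:R by lra.
have t0 : 0 < t by lra.
apply: ler_pM; rewrite ?invr_ge0 ?powR_ge0 ?(ltW t0)//.
  rewrite -[t^-1]mulr1; apply: ler_pM; rewrite ?invr_ge0 ?(ltW t0)//.
    rewrite -[t^-1]mul1r; apply: ler_pM; rewrite ?invr_ge0 ?(ltW t0)//.
    by rewrite lef_pV2 ?posrE//; lra.
  by rewrite exprn_ege1// (@le_trans _ _ 2) ?lerDl// ler1n.
rewrite -(mulN1r (t - m%:R)) powRrM powR_inv1//; apply: ge0_ler_powR;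
  rewrite ?nnegrE ?invr_ge0 ?(ltW tm0)//.
by rewrite ler_peMl// invr_ge0.
Qed.

(** The square root of the kernel bound times the Fourier tail beyond M. Passing from M to N costs a
    power of d K, and m <= d keeps the constant independent of m. *)
Lemma aliasing_tail_le (R : realType) (alpha t : R) (d : nat) (K : nat) :
  - 2^-1 <= alpha -> 0 < t -> (0 < d)%N -> (0 < K)%N ->
  exists2 C : R, 0 < C & forall N m M : nat, (0 < m)%N -> (m <= d)%N -> (0 < N)%N ->
    m%:R + 1 < t -> (N.+1 <= d * K * M.+1)%N ->
    N.+1%:R `^ ((alpha + 1) * m%:R) * M.+1%:R `^ (2^-1 - t)
    <= C * (D_const N alpha ^+ m * (m%:R / (t - m%:R) * (2 + m%:R / N.+1%:R) ^+ d
            * (m%:R / N.+1%:R) `^ (t - m%:R))).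
Proof.
move=> ha t0 d0 K0.
have a0 : 0 <= alpha + 2^-1 by lra.
have dK0 : 0 < (d * K)%N%:R :> R by rewrite ltr0n muln_gt0 d0.
exists ((d * K)%N%:R `^ (t - 2^-1) * (t * 2 `^ ((alpha + 2^-1) * d%:R))).
  by rewrite !mulr_gt0 ?powR_gt0.
move=> N m M m0 md N0 mt NM.
have m1 : 1 <= m%:R :> R by rewrite ler1n.
have N1 : 1 <= N.+1%:R :> R by rewrite ler1n.
have Nneq0 : N.+1%:R != 0 :> R by rewrite pnatr_eq0.
have NP : 0 < N.+1%:R :> R by rewrite ltr0n.
have hM : M.+1%:R `^ (2^-1 - t) <= (d * K)%N%:R `^ (t - 2^-1)
  * N.+1%:R `^ (2^-1 - t) :> R.
  rewrite -[2^-1 - t]opprB !powRN ler_pdivlMr ?powR_gt0// mulrC ler_pdivrMr ?powR_gt0//.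
  rewrite -powRM//; apply: ge0_ler_powR; rewrite ?nnegrE ?mulr_ge0//; first lra.
  by rewrite -natrM ler_nat.
(* The exponents differ by (m - 1) / 2 >= 0. *)
have hN : N.+1%:R `^ ((alpha + 1) * m%:R) * N.+1%:R `^ (2^-1 - t)
    <= N.+1%:R `^ ((alpha + 2^-1) * m%:R) * N.+1%:R `^ (- (t - m%:R)) :> R.
  rewrite -!powRD ?Nneq0 ?implybT//; apply: ler_powR => //; nra.
have hD : N.+1%:R `^ ((alpha + 2^-1) * m%:R)
    <= 2 `^ ((alpha + 2^-1) * d%:R) * D_const N alpha ^+ m.
  have D0 : 0 <= D_const N alpha.
    by rewrite (le_trans _ (D_const_ge ha N0))// mulr_ge0 ?powR_ge0.
  have h : N.+1%:R `^ (alpha + 2^-1) <= 2 `^ (alpha + 2^-1) * D_const N alpha.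
    have := D_const_ge ha N0; rewrite powRN mulrC ler_pdivrMr ?powR_gt0//.
    by rewrite mulrC.
  rewrite powRrM powR_mulrn ?powR_ge0//.
  rewrite (@le_trans _ _ ((2 `^ (alpha + 2^-1) * D_const N alpha) ^+ m))//.
    by rewrite lerXn2r ?nnegrE ?mulr_ge0 ?powR_ge0.
  rewrite exprMn ler_wpM2r ?exprn_ge0// powRrM powR_mulrn ?powR_ge0//.
  rewrite ler_weXn2l//.
  by have := ler_powR (ler1n R 2) a0; rewrite powRr0.
have hT := tail_factor_ge d N m0 mt.
set T := _ * _ * _ in hT *.
have hT' : N.+1%:R `^ (- (t - m%:R)) <= t * T by rewrite -ler_pdivrMl.
apply: (le_trans (ler_wpM2l (powR_ge0 _ _) hM)).
rewrite mulrCA -!mulrA ler_wpM2l ?powR_ge0// (le_trans hN)//.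
apply: (le_trans (ler_pM (powR_ge0 _ _) (powR_ge0 _ _) hD hT')).
by rewrite le_eqVlt; apply/orP; left; apply/eqP; ring.
Qed.

Lemma projection_bounds (R : realType) (alpha : R) (d : nat) (t : R) :
  - 2^-1 <= alpha -> (0 < d)%N -> 1 <= t ->
  exists2 c : R, 0 < c & forall (P : nat -> {poly R}) (f : euclid R d
    -> R[i]) (N m : nat)
      (S h : R),
    let err := fun x => f x - jacobi_projection alpha P N m f x in
    let tail := m%:R / (t - m%:R) * (2 + m%:R / N.+1%:R) ^+ d
                * (m%:R / N.+1%:R) `^ (t - m%:R) in
    orthonormal_jacobi alpha P -> square_integrable f -> fourier_expanded f ->
    0 <= S -> 0 <= h -> S <= 2 ^+ d * h ->
    (forall B : seq (d.-tuple int), uniq B ->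
      \sum_(p <- B) normc (fourier_coef f p) <= S) ->
    (forall B : seq (d.-tuple int), uniq B ->
      \sum_(p <- B) (mixed_weight t p ^+ 2
        * normc (fourier_coef f p) ^+ 2) <= h ^+ 2) ->
    (0 < m)%N -> (m <= d)%N -> (0 < N)%N -> m%:R + 1 < t ->
    (weighted_L2_norm alpha err <= (c * h)%:E)%E /\
    forall x, cube (-1) 1 x -> normc (err x) <= c * S
      + c * (D_const N alpha ^+ m * tail * h).
Proof.
move=> ha d0 t1; have t0 : 0 < t by lra.
have a1 : 0 <= alpha + 1 by lra.
have [Cc Cc0 christ] := christoffel_bound ha.
have [C2 C20 expC2] := powR_expRN_bounded ((alpha + 1) * d%:R).
(* An integer above 2 pi e^2, the Taylor degree required per unit of frequency; the successor makes
   it positive. *)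
pose K := (Num.bound (expR 2 * (2 * pi) : R)).+1.
have p2 : 0 <= 2 * pi :> R by rewrite mulr_ge0// ltW// pi_gt0.
have K2pi : expR 2 * (2 * pi) <= K%:R :> R.
  rewrite (le_trans (ltW (archi_boundP _)))//; first by rewrite mulr_ge0 ?expR_ge0.
  by rewrite ler_nat.
have [C3 C30 alias] := @aliasing_tail_le R alpha t d K ha t0 d0 isT.
pose W := weighted_mean alpha (1 : {poly R}).
have W0 : 0 <= W by apply: Rintegral_ge0 => x _; rewrite hornerC mul1r powR_ge0.
(* At least 1 as [tensor_christoffel] requires; the case N = 0 of [christ] bounds P_0^2 by the same
   constant. *)
pose B : R := Num.max 1 Cc.
have B1 : 1 <= B by rewrite le_max lexx.
have CB : Cc <= B by rewrite le_max lexx orbT.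
pose V : R := Num.sqrt (W ^+ d * (2 ^+ d * B ^+ d)).
have V0 : 0 <= V by exact: sqrtr_ge0.
(* c0 serves the weighted norm, its 2^d coming from S <= 2^d h; c1 collects f, T and the Taylor
   error; c2 comes from the Fourier tail. *)
pose c0 : R := 2 ^+ d * ((W ^+ d *+ 2) `^ 2^-1).
pose c1 : R := 1 + 16 ^+ d + 2 * V * (d%:R * 4 ^+ d * 2 * (d%:R `^ ((alpha
  + 1) * d%:R) * C2)).
pose c2 : R := 2 * V * (d%:R * 2 ^+ d * C3).
have c00 : 0 <= c0 by rewrite mulr_ge0 ?exprn_ge0 ?powR_ge0.
have c10 : 0 < c1.
  by rewrite ltr_wpDr ?ltr_wpDl ?exprn_ge0// !mulr_ge0 ?exprn_ge0 ?powR_ge0// ltW.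
have c20 : 0 <= c2 by rewrite !mulr_ge0 ?exprn_ge0// ltW.
exists (c0 + c1 + c2); first by lra.
move=> P f N m S h err tail oP [mre mim _] fE S0 h0 Sh fS fh m0 md N0 mt.
have fS' y : normc (f y) <= S by exact: fourier_expanded_normc_le.
have [_ ftail] := fourier_coef_summable t1 h0 fh.
split.
  have bre : cube_bounded (fun x => complex.Re (f x)).
    by split => //; exists S => y _; exact: le_trans (normr_Re_le _) (fS' y).
  have bim : cube_bounded (fun x => complex.Im (f x)).
    by split => //; exists S => y _; exact: le_trans (normr_Im_le _) (fS' y).
  apply: (le_trans (projection_weighted_error_le N m oP S0 bre bim (fun x _ => fS' x))).
  rewrite lee_fin -mulrnAr powRM ?sqr_ge0 ?mulrn_wge0 ?exprn_ge0//.
  rewrite -powR_mulrn// -powRrM mulfV// powRr1//.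
  apply: (@le_trans _ _ (c0 * h)).
    by rewrite /c0 mulrAC ler_wpM2r ?powR_ge0.
  by rewrite ler_wpM2r//; lra.
move=> x cx.
(* Size n per coordinate keeps the total degree within N, and resolves frequencies up to M. Rounding
   is controlled by N + 1 <= d (n + 1) and n + 1 <= K (M + 1), which hold even if n or M is 0. *)
pose n := (N %/ d)%N; pose M := (n %/ K)%N.
have dnN : (d * n <= N)%N by rewrite mulnC leq_divM.
have KM : (K * M <= n)%N by rewrite mulnC leq_divM.
have Nn : (N.+1 <= d * n.+1)%N by rewrite mulnC ltn_ceil.
have nM : (n.+1 <= K * M.+1)%N by rewrite mulnC ltn_ceil.
have NM : (N.+1 <= d * K * M.+1)%N.
  by rewrite (leq_trans Nn)// -mulnA leq_pmul2l.
pose Y : R := N.+1%:R `^ (2 * alpha + 2).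
have N1 : 1 <= N.+1%:R :> R by rewrite ler1n.
have Y1 : 1 <= Y.
  have q0 : 0 <= 2 * alpha + 2 by lra.
  by have := ler_powR N1 q0; rewrite powRr0.
have P0B y : -1 <= y <= 1 -> (P 0).[y] ^+ 2 <= B.
  move=> y11; have := christ P oP 0%N y y11.
  by rewrite big_ord1 powR1 mulr1 => /le_trans; apply.
have PBY y : -1 <= y <= 1 -> \sum_(i < N.+1) (P i).[y] ^+ 2 <= B * Y.
  move=> y11; rewrite (le_trans (christ P oP N y y11))//.
  by rewrite ler_wpM2r ?powR_ge0.
pose tau := d%:R * 2 ^+ d * M.+1%:R `^ (2^-1 - t) * h.
have tau0 : 0 <= tau by rewrite !mulr_ge0 ?exprn_ge0 ?powR_ge0.
have := @projection_sup_error_le R alpha d N m n K M P f S tau B Y x oP d0 dnN K2pi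
  KM B1 Y1 P0B PBY mre mim fE S0 tau0 fS (ftail M) cx.
set e := _ * 4 ^+ d * _.
have e0 : 0 <= e by rewrite !mulr_ge0 ?exprn_ge0 ?expR_ge0.
pose Z : R := N.+1%:R `^ ((alpha + 1) * m%:R).
have Z0 : 0 <= Z by exact: powR_ge0.
have tE0 : 0 <= tau + e * S by rewrite addr_ge0// mulr_ge0.
have sqrtE : Num.sqrt ((tau + e * S) ^+ 2 * weighted_mean alpha 1 ^+ d * (2 ^+ d
  * (B ^+ d * Y ^+ m)))
    = (tau + e * S) * V * Z.
  rewrite [X in Num.sqrt X](_ : _ = ((tau
    + e * S) ^+ 2 * (W ^+ d * (2 ^+ d * B ^+ d))) * Z ^+ 2).
    rewrite sqrtrM ?mulr_ge0 ?sqr_ge0 ?exprn_ge0 ?(le_trans _ B1)//.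
    by rewrite sqrtrM ?sqr_ge0// !sqrtr_sqr !ger0_norm.
  have -> : Y ^+ m = Z ^+ 2.
    rewrite -powR_mulrn ?powR_ge0// -powRrM -powR_mulrn ?powR_ge0// -powRrM.
    by congr (_ `^ _); ring.
  by rewrite /W; ring.
rewrite sqrtE => /le_trans; apply.
have Ztau : Z * tau <= d%:R * 2 ^+ d * C3 * (D_const N alpha ^+ m * tail * h).
  have := alias N m M m0 md N0 mt NM; rewrite -/Z => Zle.
  rewrite /tau (_ : Z * _ = d%:R * 2 ^+ d * (Z * M.+1%:R `^ (2^-1 - t)) * h);
    last by ring.
  rewrite [leRHS]mulrA ler_wpM2r// -[leRHS]mulrA ler_wpM2l ?mulr_ge0 ?exprn_ge0//.
(* Since N + 1 <= d (n + 1), the power of N is at most a constant times a power of n + 1, which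
   e^(-n) absorbs. *)
have Ze : Z * e <= d%:R * 4 ^+ d * 2 * (d%:R `^ ((alpha + 1) * d%:R) * C2).
  rewrite /e (_ : Z * _ = d%:R * 4 ^+ d * 2 * (Z * expR (- n%:R))); last by ring.
  rewrite ler_wpM2l ?mulr_ge0 ?exprn_ge0//.
  apply: (@le_trans _ _ (d%:R `^ ((alpha + 1) * d%:R) * (n.+1%:R `^ ((alpha
    + 1) * d%:R) * expR (- n%:R)))).
    rewrite mulrA ler_wpM2r ?expR_ge0// -powRM//.
    apply: (@le_trans _ _ (N.+1%:R `^ ((alpha + 1) * d%:R))).
      by apply: ler_powR => //; rewrite ler_wpM2l// ler_nat.
    apply: ge0_ler_powR; rewrite ?nnegrE ?mulr_ge0//.
    by rewrite -natrM ler_nat.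
  by rewrite ler_wpM2l ?powR_ge0.
have tailD0 : 0 <= D_const N alpha ^+ m * tail * h.
  have D0 : 0 <= D_const N alpha.
    by rewrite (le_trans _ (D_const_ge ha N0))// mulr_ge0 ?powR_ge0.
  have tl0 : 0 <= tail by rewrite (le_trans _ (tail_factor_ge d N m0 mt))// mulr_ge0
    ?invr_ge0 ?powR_ge0 ?(ltW t0).
  by apply: mulr_ge0 => //; apply: mulr_ge0 => //; exact: exprn_ge0.
apply: (@le_trans _ _ (c1 * S + c2 * (D_const N alpha ^+ m * tail * h))).
  rewrite (_ : _ + _ = (1 + 16 ^+ d) * S + 2 * V * (Z * e) * S + 2 * V * (Z * tau));
    last by ring.
  apply: lerD.
    by rewrite -mulrDl; apply: ler_wpM2r => //; rewrite lerD2l ler_wpM2l// mulr_ge0.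
  by rewrite /c2 -[leRHS]mulrA ler_wpM2l// mulr_ge0.
by apply: lerD; apply: ler_wpM2r => //; lra.
Qed.

Theorem theorem3 (R : realType) (alpha : R) (d : nat) (s : R)
    (halpha : - 2^-1 <= alpha) (hd : (1 <= d)%N) (hs : 0 < s) :
  exists c : R, 0 < c /\
    forall (P : nat -> {poly R}) (xi : R) (f : euclid R d -> R[i])
      (N m : nat),
    let t := s + d%:R / 2 in
    let r := m%:R / (N.+1)%:R in
    let normf := (L2_norm f + H_norm t f)%E in
    let err : euclid R d -> R[i] :=
      fun x => f x - jacobi_projection alpha P N m f x in
    let tail := m%:R / (t - m%:R) * (2 + r) ^+ d * r `^ (t - m%:R) in
    orthonormal_jacobi alpha P ->
    0 < xi -> xi < 2^-1 ->
    H_space t f ->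
    (1 <= m)%N -> (m <= minn N d)%N ->
    expR (1 : R) * m%:R - 1 < N%:R ->
    - ln xi * (1 + s + d%:R / 2)
      <= ((N.+1)%:R / m%:R) / ln ((N.+1)%:R / m%:R) ->
    m%:R + 1 < t ->
    (weighted_L2_norm alpha err
      <= c%:E * (((2 `^ (t * (m%:R + 1)))^-1)%:E * H_norm t f
                 + tail%:E * normf))%E /\
    (sup_norm err
      <= c%:E * (((2 `^ (t * (m%:R + 1)))^-1)%:E * A_norm s f
                 + (D_const N alpha ^+ m * tail)%:E * normf))%E.
Proof.
(* If t < 1 then m + 1 < t is impossible and any constant works; otherwise 2 t >= 2, as
   [fourier_coef_summable] needs. *)
have [t1|t1] := ltP (s + d%:R / 2) 1.
  have vacuous (m : nat) : ~~ (m%:R + 1 < s + d%:R / 2).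
    by rewrite -leNgt (le_trans (ltW t1))// lerDr.
  exists 1; split => // P xi f N m t r normf err tail _ _ _ _ _ _ _ _ mt.
  by have := vacuous m; rewrite mt.
have [c c0 bounds] := projection_bounds halpha hd t1.
(* The inverse of the factor 2^(-t (m + 1)) at m = d, hence at least its inverse for every m <=
   d. *)
pose kappa : R := 2 `^ ((s + d%:R / 2) * (d%:R + 1)).
have kappa0 : 0 < kappa by rewrite powR_gt0.
have key k u v : 0 <= k -> 1 <= kappa * k -> 0 <= u -> 0 <= v ->
    c * u + c * v <= (c * kappa + c) * (k * u + v).
  move=> k0 kk u0 v0.
  have h1 : c * u <= c * kappa * k * u.
    by rewrite -!mulrA ler_pM2l// mulrA ler_peMl.
  have h2 : 0 <= c * k * u by rewrite !mulr_ge0// ltW.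
  have h3 : 0 <= c * kappa * v by rewrite !mulr_ge0// ltW.
  rewrite (_ : _ * (_ + _) = c * kappa * k * u + c * v + c * k * u + c * kappa * v);
    last by ring.
  by lra.
exists (c * kappa + c); split; first by rewrite addr_gt0// mulr_gt0.
move=> P xi f N m t r normf err tail oP _ _ [_ sqf fE Hfin] m1 mNd _ _ mt.
move: mNd; rewrite leq_min => /andP[mN md].
have N0 : (0 < N)%N by exact: leq_trans mN.
have [h h0 [Hh fh]] := H_norm_finite Hfin.
have [bS _] := fourier_coef_summable t1 h0 fh.
pose b (p : d.-tuple int) := normc (fourier_coef f p).
(* S is the unweighted sum of the moduli of the Fourier coefficients, finite because the H-norm
   is. *)
have [S S0 [SE Sh]] : exists2 S : R, 0 <= S &
    (\esum_(p in [set: d.-tuple int]) (b p)%:E)%E = S%:E /\ S <= 2 ^+ d * h.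
  have := esum_le_sum bS.
  have : (0 <= \esum_(p in [set: d.-tuple int]) (b p)%:E)%E.
    by apply: esum_ge0 => p _; rewrite lee_fin normc_ge0.
  rewrite -/b; case: (\esum_(p in _) _)%E => [S||]//; rewrite !lee_fin => S0 Sh.
  by exists S.
have fS B : uniq B -> \sum_(p <- B) b p <= S.
  by move=> uB; rewrite -lee_fin -SE; exact: esum_ge_sum.
(* The weights are at least 1 as s >= 0. The comparison takes place in the extended reals, where the
   Wiener norm may be infinite. *)
have SA : (S%:E <= A_norm s f)%E.
  rewrite -SE; apply: le_esum => p _; rewrite lee_fin ler_peMl ?normc_ge0//.
  by apply: mixed_weight_ge1; exact: ltW.
have [L2 sup] := bounds P f N m S h oP sqf fE S0 h0 Sh fS fh m1 md N0 mt.
have hn : (h%:E <= normf)%E.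
  by rewrite /normf Hh leeDr// /L2_norm poweR_ge0.
set k := (2 `^ (t * (m%:R + 1)))^-1.
have t0 : 0 <= t by rewrite (le_trans _ t1).
have kk : 1 <= kappa * k.
  rewrite ler_pdivlMr ?powR_gt0// mul1r; apply: ler_powR; first by rewrite ler1n.
  by rewrite ler_wpM2l// lerD2r ler_nat.
have k0 : 0 <= k by rewrite invr_ge0 powR_ge0.
have tail0 : 0 <= tail.
  rewrite (le_trans _ (tail_factor_ge d N m1 mt))// mulr_ge0 ?powR_ge0//.
  by rewrite invr_ge0.
have D0 : 0 <= D_const N alpha.
  by rewrite (le_trans _ (D_const_ge halpha N0))// mulr_ge0 ?powR_ge0.
have Dm0 : 0 <= D_const N alpha ^+ m * tail by rewrite mulr_ge0 ?exprn_ge0.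
have c'0 : 0 <= c * kappa + c by rewrite addr_ge0 ?mulr_ge0 ?ltW.
split.
  apply: (le_trans L2).
  apply: (@le_trans _ _ ((c * kappa + c)%:E * (k%:E * h%:E + tail%:E * h%:E))%E).
    rewrite [leRHS](_ : _ = ((c * kappa + c) * (k * h
      + tail * h))%:E)// lee_fin (le_trans _ (key k h (tail * h) k0 kk h0 _))//.
      by rewrite lerDl; apply: mulr_ge0; [exact: ltW|exact: mulr_ge0].
    exact: mulr_ge0.
  by rewrite Hh lee_wpmul2l ?lee_fin// leeD2l// lee_wpmul2l ?lee_fin.
apply: ge_ereal_sup => _ [x cx <-].
apply: (@le_trans _ _ ((c * kappa + c)%:E * (k%:E * S%:E
  + (D_const N alpha ^+ m * tail)%:E * h%:E))%E).
  rewrite [leRHS](_ : _ = ((c * kappa + c) * (k * S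
    + D_const N alpha ^+ m * tail * h))%:E)//.
  rewrite lee_fin (le_trans (sup x cx))// key//.
  by rewrite mulr_ge0.
rewrite lee_wpmul2l ?lee_fin// leeD//; apply: lee_wpmul2l; rewrite ?lee_fin//.
Qed.
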